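(* Let $\mathcal{G}$ be an additive arithmetical semigroup satisfying Axiom $A^{\#}$ (constants $c_{\mathcal{G}}>0$, $q>1$, $0\le\eta<1$) with $Z_{\mathcal{G}}(-q^{-1})\ne0$ and norm $\|g\|=q^{\partial(g)}$, and let $S\subseteq\mathcal{P}$ have natural density $\delta(S)$. Let $f\colon\mathbb{Z}_{\ge0}\to\mathbb{C}$ be bounded with $f(0)=0$, and let $a\colon\mathcal{G}\to\mathbb{C}$ be supported on $\mathfrak{D}(\mathcal{G},S)$ with $a(e_{\mathcal{G}})=1$ and $\lim_{n\to\infty}\sum_{1\le\partial(g)\le n,\ g\in\mathfrak{D}(\mathcal{G},S)}\frac{|a(g)|}{\|g\|}\log\log\|g\|<\infty$. Then the following three statements are equivalent: (i) $\sum_{\partial(g)=n}Q_S(g)f(d^+(g))=c_{\mathcal{G}}\delta(S)q^n+o(q^n)$ as $n\to\infty$; (ii) $-\lim_{n\to\infty}\sum_{1\le\partial(g)\le n,\ g\in\mathfrak{D}(\mathcal{G},S)}\frac{\mu(g)f(d_-(g))}{\|g\|}=\delta(S)$; (iii) $-\lim_{n\to\infty}\sum_{1\le\partial(g)\le n,\ g\in\mathfrak{D}(\mathcal{G},S)}\frac{(\mu*a)(g)f(d_-(g))}{\|g\|}=\delta(S)$.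
   Context: An additive arithmetical semigroup is a commutative monoid $\mathcal{G}$ (written additively, identity $e_{\mathcal{G}}$) freely generated by a countable set $\mathcal{P}$ of primes, with an additive degree map $\partial\colon\mathcal{G}\to\mathbb{Z}_{\ge0}$, $\partial(e_{\mathcal{G}})=0$, $\partial(P)>0$ for primes, finitely many elements of each degree. Axiom $A^{\#}$: $\#\{g:\partial(g)=n\}=c_{\mathcal{G}}q^n+O(q^{\eta n})$. $Z_{\mathcal{G}}(z)=\prod_{P\in\mathcal{P}}(1-z^{\partial(P)})^{-1}$ (meromorphically continued). Natural density: $\delta(S)=\lim_{n\to\infty}\#\{P\in S:\partial(P)=n\}/\#\{P\in\mathcal{P}:\partial(P)=n\}$. $h\mid g$ iff $g=h+r$, and $g-h:=r$. For $g\ne e_{\mathcal{G}}$, $d_-(g)$ and $d^+(g)$ are the minimal and maximal degrees of primes dividing $g$; $d^+(e_{\mathcal{G}})=0$. $g$ distinguishable: $g\ne e_{\mathcal{G}}$ and a unique prime $P_{\min}(g)\mid g$ has degree $d_-(g)$. $\mathfrak{D}(\mathcal{G},S)=\{g\text{ distinguishable}:P_{\min}(g)\in S\}\cup\{e_{\mathcal{G}}\}$. $Q_S(g)=\#\{P\in S:P\mid g,\ \partial(P)=d^+(g)\}$. $\mu$ is the Möbius function of $\mathcal{G}$; $(\mu*a)(g)=\sum_{h\mid g}\mu(h)a(g-h)$; $a$ supported on $\mathfrak{D}(\mathcal{G},S)$ means $a$ vanishes outside it. *)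

(* Defs.v *)
From HB Require Import structures.
From mathcomp Require Import all_boot all_order all_algebra.
From mathcomp Require Import all_classical all_reals all_analysis.
From mathcomp Require Import complex.
From mathcomp Require Import finmap multiset.
Import numFieldNormedType.Exports.
Import Order.TTheory GRing.Theory Num.Theory.

Set Implicit Arguments.
Unset Strict Implicit.
Unset Printing Implicit Defensive.

Local Open Scope mset_scope.
Local Open Scope classical_set_scope.
Local Open Scope ring_scope.

(* A commutative monoid freely generated by a (countable) set P of      *)
(* primes is, up to isomorphism, the monoid {mset P} of finite          *)
(* multisets of primes, with addition `+` (msetD), identity mset0.      *)
(* The degree map is determined by its (positive) values on primes:     *)
(*   deg g = sum over the primes of g (with multiplicity) of deg p.     *)

Section AAS.
Variables (P : countType) (deg : P -> nat).

Definition mdeg (g : {mset P}) : nat := (\sum_(p <- g) deg p)%N.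

Definition dplus (g : {mset P}) : nat := (\max_(p <- finsupp g) deg p)%N.

(* d_-(g): minimal degree of a prime dividing g (g <> e);
   conventionally 0 for g = e (never used there). *)
Definition dminus (g : {mset P}) : nat :=
  if g == mset0 then 0%N else \big[minn/dplus g]_(p <- finsupp g) deg p.

Definition distinguishable (g : {mset P}) : bool :=
  (g != mset0) && (count (fun p => deg p == dminus g) (finsupp g) == 1)%N.

(* P_min(g): the prime of g of minimal degree (meaningful when g is
   distinguishable) *)
Definition Pmin (g : {mset P}) : option P :=
  ohead [seq p <- finsupp g | deg p == dminus g].

Definition inD (S : set P) (g : {mset P}) : Prop :=
  g = mset0 \/ (distinguishable g /\ exists2 p, Pmin g = Some p & S p).

Definition QS (S : set P) (g : {mset P}) : nat :=
  count (fun p => `[< S p >] && (deg p == dplus g)) (finsupp g).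

Definition mobius (R : pzRingType) (g : {mset P}) : R :=
  if all (fun p => (g p <= 1)%N) (finsupp g) then (-1) ^+ size g else 0.

(* Dirichlet convolution (mu * a)(g) = sum_{h | g} mu(h) a(g - h),
   where h | g iff g = h + r, i.e. h is a sub-multiset of g, and g - h = r *)
Definition mu_conv (R : pzRingType) (a : {mset P} -> R) (g : {mset P}) : R :=
  \sum_(h \in [set h : {mset P} | (h `<=` g)%mset]) mobius R h * a (g `\` h)%mset.

Definition Gcount (R : pzRingType) (n : nat) : R :=
  \sum_(g \in [set g : {mset P} | mdeg g = n]) (1 : R).

Definition pcount (n : nat) : nat :=
  (\sum_(p \in [set p : P | deg p = n]) 1)%N.
Definition pcountS (S : set P) (n : nat) : nat :=
  (\sum_(p \in [set p : P | S p /\ deg p = n]) 1)%N.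

End AAS.

(* Z_G(x) = prod_P (1 - x^{deg P})^{-1}, for real x with |x| < 1/q,
   computed as the limit of the partial products over primes of degree
   <= N (grouped by degree). *)
Definition Zpart (R : realType) (P : countType) (deg : P -> nat) (N : nat) (x : R) : R :=
  \prod_(1 <= n < N.+1) (1 - x ^+ n) ^- (pcount deg n).
Definition ZG (R : realType) (P : countType) (deg : P -> nat) (x : R) : R :=
  lim (Zpart deg N x @[N --> \oo]).

Definition cvgC (R : realType) (u : nat -> R[i]) (l : R[i]) : Prop :=
  Normc.normc (u n - l) @[n --> \oo] --> (0 : R).

(* Main.v *)
(* Write D for the distinguishable elements with minimal prime in S. Moebius
   duality, sum_(h | g) mu(h) 1_D(h) f(d_-(h)) = - Q_S(g) f(d^+(g)), says that the
   level sums in (i), divided by q^n, are minus the convolution of the terms of (ii)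
   with G(n) q^-n, where G(n) q^-n - c is geometrically small. So (ii) gives (i)
   directly, and (i) gives (ii) as soon as the inverse of phi(z) = (1 - z) Z(z / q)
   has absolutely summable coefficients. phi extends smoothly to the closed unit
   disc and has no zero there: inside by the Euler product, at 1 because phi(1) = c,
   at -1 by hypothesis, elsewhere on the circle by a 3-4-1 argument, applied to each
   Euler factor. Summability then follows from Newman's proof of Wiener's lemma.
   The difference of the sums in (iii) and (ii) is a sum over h in D, h nonzero, of
   a(h) / |h| times a partial sum of mu(r) f(d_-(r + h)) / |r|. Each of these tends
   to 0 and is O(1 + sum_(deg p <= deg h) 1 / |p|) = O(log log |h|) by a Mertens
   bound, so dominated convergence applies. *)

Require Import Defs.
From mathcomp Require Import all_boot all_order all_algebra.
From mathcomp Require Import all_classical all_reals all_analysis.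
From mathcomp Require Import complex.
From mathcomp Require Import finmap multiset.
From mathcomp Require Import cyclic separable cyclotomic polyrcf.
From mathcomp Require Import ring lra zify.
Import numFieldNormedType.Exports.
Import Order.TTheory GRing.Theory Num.Theory.

Set Implicit Arguments.
Unset Strict Implicit.
Unset Printing Implicit Defensive.

Local Open Scope mset_scope.
Local Open Scope classical_set_scope.
Local Open Scope ring_scope.

Local Notation nc := Normc.normc.

(** Everything is done on coefficient sequences: sums by degree turn convolution on the monoid into
    the Cauchy product [conv], and division by q^n moves the critical circle to |z| = 1. Because (i)
    comes without a rate, its convolution identity can only be inverted by an absolutely summable
    sequence. That sequence is [invb], the partial sums of mu(g) / |g|, and the partial sums in (ii)
    are exactly minus its convolution with the left side of (i). Fixing the minimal prime p of an
    element leaves cofactors whose primes have degree above deg p (or equal p, in (iii)), so Moebius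
    sums restricted to a set A of primes are unavoidable. Two facts about them are needed. If A
    omits only primes of bounded degree, they tend to 0, since they are [invb] convolved with a
    finite Euler product. For every A they are bounded by one constant, by an elementary argument
    ([psum_mm_bound]). The speed of the first depends on A, so only the second can supply a majorant
    for dominated convergence. *)

Definition conv (K : comNzRingType) (u v : nat -> K) (n : nat) : K :=
  \sum_(i < n.+1) u i * v (n - i)%N.

Definition psum (K : nmodType) (u : nat -> K) (n : nat) : K :=
  \sum_(i < n.+1) u i.

(** * Cauchy products and partial sums *)

Section Convolution.
Variable K : comNzRingType.
Implicit Types u v w : nat -> K.

(** Coefficient n sees only indices up to n, so truncation to polynomials transfers the ring laws to
    [conv]. *)
Lemma conv_coef u v m n : (n < m)%N ->
  conv u v n = ((\poly_(i < m) u i) * (\poly_(i < m) v i))`_n.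
Proof.
move=> nm; rewrite coefM; apply: eq_bigr => i _; rewrite !coef_poly.
by rewrite !ifT //; have := ltn_ord i; lia.
Qed.

Lemma convC u v : conv u v =1 conv v u.
Proof. by move=> n; rewrite !(conv_coef _ _ (ltnSn n)) mulrC. Qed.

Lemma eq_conv u u' v v' : u =1 u' -> v =1 v' -> conv u v =1 conv u' v'.
Proof. by move=> uu' vv' n; apply: eq_bigr => i _; rewrite uu' vv'. Qed.

Lemma convA u v w : conv u (conv v w) =1 conv (conv u v) w.
Proof.
move=> n; pose p x := \poly_(i < n.+1) (x i : K).
have cE x y i : (i <= n)%N -> conv x y i = (p x * p y)`_i.
  by move=> le_in; rewrite (@conv_coef _ _ n.+1).
transitivity ((p u * (p v * p w))`_n).
  rewrite coefM; apply: eq_bigr => i _; rewrite coef_poly ltn_ord cE //.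
  by rewrite leq_subr.
rewrite mulrA coefM; apply: eq_bigr => i _.
have hi := ltn_ord i; rewrite cE ?coef_poly; last by lia.
by rewrite ifT // ltnS leq_subr.
Qed.

Lemma conv_delta u : conv u (fun n => (n == 0%N)%:R) =1 u.
Proof.
move=> n; rewrite /conv big_ord_recr /= subnn eqxx mulr1 big1 ?add0r // => i _.
by rewrite subn_eq0 leqNgt ltn_ord mulr0.
Qed.

Lemma convDr u v w : conv u (fun n => v n + w n) =1 (fun n => conv u v n + conv u w n).
Proof. by move=> n; rewrite -big_split; apply: eq_bigr => i _; rewrite mulrDr. Qed.

Lemma convNl u v n : conv (fun i => - u i) v n = - conv u v n.
Proof. by rewrite /conv -sumrN; apply: eq_bigr => i _; rewrite mulNr. Qed.

Lemma conv1 u : conv u (fun=> 1) =1 psum u.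
Proof. by move=> n; apply: eq_bigr => i _; rewrite mulr1. Qed.

(** Partial summation is convolution with the constant sequence 1, so this is associativity. *)
Lemma psum_conv u v : psum (conv u v) =1 conv u (psum v).
Proof.
move=> n; rewrite -conv1 -convA; apply: eq_conv => // m; exact: conv1.
Qed.

Lemma conv_twist r u v n :
  conv (fun i => u i * r ^+ i) (fun i => v i * r ^+ i) n = conv u v n * r ^+ n.
Proof.
rewrite /conv mulr_suml; apply: eq_bigr => i _.
by rewrite mulrACA -exprD subnKC // -ltnS.
Qed.

Lemma psumS (u : nat -> K) n : psum u n.+1 = psum u n + u n.+1.
Proof. by rewrite /psum big_ord_recr. Qed.

Lemma psum0 (u : nat -> K) : psum u 0 = u 0%N.
Proof. by rewrite /psum big_ord1. Qed.

End Convolution.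

Lemma rmorph_conv (K L : comNzRingType) (f : {rmorphism K -> L}) u v n :
  f (conv u v n) = conv (f \o u) (f \o v) n.
Proof. by rewrite rmorph_sum; apply: eq_bigr => i _; rewrite rmorphM. Qed.

(** * Tails of bounded series and dominated convergence *)

Section RealSequences.
Variable R : realType.
Implicit Types (u v w : nat -> R).

Lemma cvg0_le u v : (forall n, `|u n| <= v n) ->
  v n @[n --> \oo] --> (0 : R) -> u n @[n --> \oo] --> (0 : R).
Proof.
move=> uv v0; apply/norm_cvg0P.
by apply: (squeeze_cvgr _ (@cvg_cst _ _ _ _ _) v0); near=> n; rewrite normr_ge0 uv.
Unshelve. all: by end_near. Qed.

Lemma sum_tail_le u (B : R) : (forall n, 0 <= u n) ->
    (forall N, \sum_(i < N) u i <= B) ->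
  forall e : R, 0 < e -> exists K, forall N, \sum_(K <= i < N) u i <= e.
Proof.
move=> u0 uB e e0.
pose s N := \sum_(0 <= i < N) u i.
have snd : nondecreasing_seq s.
  apply/nondecreasing_seqP => n; rewrite /s big_nat_recr //=.
  by rewrite lerDl.
have sB : has_ubound (range s).
  by exists B => _ [N _ <-]; rewrite /s big_mkord.
have cs := nondecreasing_is_cvgn snd sB.
have [K _ HK] : \forall K \near \oo, lim (s n @[n --> \oo]) - e < s K.
  by apply: (cvgr_gt _ cs); rewrite ltrBlDr ltrDl.
exists K => N; have [KN|NK] := leqP K N; last first.
  by rewrite big_geq ?(ltnW NK) // ltW.
have -> : \sum_(K <= i < N) u i = s N - s K.
  by rewrite /s [in RHS](big_cat_nat (leq0n K) KN) //= addrAC subrr add0r.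
rewrite lerBlDl (le_trans (nondecreasing_cvgn_le snd cs N)) // -lerBlDr.
exact: ltW (HK K (leqnn K)).
Qed.

(** Dominated convergence for triangular sums: the majorant is required only for k <= n, the range
    that is summed. A tail of [w] is made small, and the finite head tends to 0 termwise. *)
Lemma tannery (t : nat -> nat -> R) w (B : R) :
    (forall k n, (k <= n)%N -> 0 <= t k n <= w k) ->
    (forall k, t k n @[n --> \oo] --> (0 : R)) ->
    (forall N, \sum_(k < N) w k <= B) ->
  \sum_(k < n.+1) t k n @[n --> \oo] --> (0 : R).
Proof.
move=> tw t0 wB.
have w0 k : 0 <= w k by have /andP[/le_trans] := tw k k (leqnn k); apply.
apply/cvgrPdist_lt => e e0.
have [K HK] := sum_tail_le w0 wB (divr_gt0 e0 (ltr0n R 2)).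
have : \sum_(k < K) t k n @[n --> \oo] --> (0 : R).
  elim: K {HK} => [|K IH].
    by under eq_fun do rewrite big_ord0; apply: cvg_cst.
  under eq_fun do rewrite big_ord_recr /=.
  by have := cvgD IH (t0 K); rewrite addr0; apply.
move/cvgrPdist_lt => /(_ (e / 2) (divr_gt0 e0 (ltr0n R 2))) H.
near=> n.
have Kn : (K <= n.+1)%N by near: n; exists K => // m /= ?; lia.
have : `|0 - \sum_(k < K) t k n| < e / 2 by near: n.
rewrite !sub0r !normrN !ger0_norm; last 2 first.
- by apply: sumr_ge0 => k _; have /andP[] := tw k n (ltnSE (ltn_ord k)).
- apply: sumr_ge0 => k _; have kn : (k <= n)%N by have := ltn_ord k; lia.
  by have /andP[] := tw k n kn.
have -> : \sum_(k < n.+1) t k n = \sum_(0 <= k < n.+1) t k n by rewrite big_mkord.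
rewrite (big_cat_nat (leq0n K) Kn) //= big_mkord.
suff : \sum_(K <= k < n.+1) t k n <= e / 2 by lra.
apply: le_trans (HK n.+1); rewrite big_nat_cond [leRHS]big_nat_cond.
by apply: ler_sum => k /andP[/andP[_ kn] _]; have /andP[] := tw k n kn.
Unshelve. all: by end_near. Qed.

Lemma cvg0_bounded u : u n @[n --> \oo] --> (0 : R) ->
  exists B : R, forall n, `|u n| <= B.
Proof.
move=> u0; have /cvgP/cvg_seq_bounded[M [_ HM]] := u0.
by exists (M + 1) => n; apply: (HM (M + 1)); rewrite // ltrDl.
Qed.

Lemma conv_cvg0 u v (B : R) : u n @[n --> \oo] --> (0 : R) ->
    (forall n, 0 <= u n) -> (forall n, 0 <= v n) ->
    (forall N, \sum_(k < N) v k <= B) ->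
  conv v u n @[n --> \oo] --> (0 : R).
Proof.
move=> u0 up vp vB; have [D HD] := cvg0_bounded u0.
apply: (@tannery (fun k n => v k * u (n - k)%N) (fun k => v k * D) (B * D)).
- move=> k n kn; rewrite mulr_ge0 //= ler_wpM2l //.
  exact: le_trans (ler_norm _) (HD _).
- move=> k; rewrite -(mulr0 (v k)); apply: cvgMl_tmp.
  by rewrite (cvg_centern k).
- move=> N; rewrite -mulr_suml ler_wpM2r //.
  by apply: le_trans (HD 0%N); rewrite normr_ge0.
Qed.

Lemma geometric_psum_le (r : R) n : 0 <= r -> r < 1 -> \sum_(k < n) r ^+ k <= (1 - r)^-1.
Proof.
move=> r0 r1; have r10 : 0 < 1 - r by rewrite subr_gt0.
rewrite -(ler_pM2l r10) mulfV ?gt_eqF //.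
have := subrX1 r n; have := exprn_ge0 n r0; lra.
Qed.

End RealSequences.

(** * Absolutely convergent complex series *)

Section ComplexSequences.
Variable R : realType.
Implicit Types (u v : nat -> R[i]) (x y z l m : R[i]) (B r : R).

Lemma nc_ge0 z : 0 <= nc z.
Proof. by case: z => a b /=; exact: sqrtr_ge0. Qed.

Lemma ncD x y : nc (x + y) <= nc x + nc y.
Proof. exact: (@le_normcD R x y). Qed.

Lemma ncN z : nc (- z) = nc z.
Proof. exact: (@normcN R z). Qed.

Lemma nc_distC x y : nc (x - y) = nc (y - x).
Proof. by rewrite -ncN opprB. Qed.

Lemma ncM x y : nc (x * y) = nc x * nc y.
Proof. exact: Normc.normcM. Qed.

Lemma ncX z n : nc (z ^+ n) = nc z ^+ n.
Proof. by elim: n => [|n IH]; rewrite ?expr0 ?Normc.normc1 // !exprS ncM IH. Qed.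

Lemma nc_real r : nc r%:C%C = `|r|.
Proof. by rewrite /= expr0n /= addr0 sqrtr_sqr. Qed.

Lemma nc_real_ge0 r : 0 <= r -> nc r%:C%C = r.
Proof. by move=> r0; rewrite nc_real ger0_norm. Qed.

Lemma nc_sum (I : Type) (s : seq I) (P : pred I) (F : I -> R[i]) :
  nc (\sum_(i <- s | P i) F i) <= \sum_(i <- s | P i) nc (F i).
Proof.
elim/big_ind2: _ => //; first by rewrite Normc.normc0.
by move=> x1 x2 y1 y2 h1 h2; rewrite (le_trans (ncD _ _)) // lerD.
Qed.

Lemma ler_nc_dist x y : `|nc x - nc y| <= nc (x - y).
Proof.
have := ncD (x - y) y; have := ncD (y - x) x; rewrite !subrK (nc_distC y).
by rewrite ler_norml; move=> h1 h2; apply/andP; split; lra.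
Qed.

Lemma sqr_nc z : nc z ^+ 2 = complex.Re z ^+ 2 + complex.Im z ^+ 2.
Proof. by case: z => a b /=; rewrite sqr_sqrtr // addr_ge0 ?sqr_ge0. Qed.

Lemma normr_Re z : `|complex.Re z| <= nc z.
Proof.
rewrite -(@ler_pXn2r _ 2) ?nnegrE ?nc_ge0 // sqr_nc real_normK ?num_real //.
by rewrite lerDl sqr_ge0.
Qed.

Lemma normr_Im z : `|complex.Im z| <= nc z.
Proof.
rewrite -(@ler_pXn2r _ 2) ?nnegrE ?nc_ge0 // sqr_nc real_normK ?num_real //.
by rewrite lerDr sqr_ge0.
Qed.

Lemma nc_le_ReIm z : nc z <= `|complex.Re z| + `|complex.Im z|.
Proof.
rewrite -(@ler_pXn2r _ 2) ?nnegrE ?nc_ge0 ?addr_ge0 // sqr_nc sqrrD.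
rewrite !real_normK ?num_real // addrAC lerDl.
by rewrite mulrn_wge0 // mulr_ge0.
Qed.

Lemma cvgC_le u l (e : nat -> R) : (forall n, nc (u n - l) <= e n) ->
  e n @[n --> \oo] --> (0 : R) -> cvgC u l.
Proof. by move=> ue; apply: cvg0_le => n; rewrite ger0_norm ?nc_ge0. Qed.

Lemma cvgC_cst l : cvgC (fun=> l) l.
Proof. by rewrite /cvgC subrr Normc.normc0; exact: cvg_cst. Qed.

Lemma eq_cvgC u v l : u =1 v -> cvgC u l -> cvgC v l.
Proof. by move=> /funext ->. Qed.

Lemma cvgC_D u v l m : cvgC u l -> cvgC v m -> cvgC (fun n => u n + v n) (l + m).
Proof.
move=> ul vm; apply: (@cvgC_le _ _ (fun n => nc (u n - l) + nc (v n - m))).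
  by move=> n; rewrite opprD addrACA ncD.
by have := cvgD ul vm; rewrite addr0; apply.
Qed.

Lemma cvgC_N u l : cvgC u l -> cvgC (fun n => - u n) (- l).
Proof. by apply: cvgC_le => n; rewrite -opprD ncN. Qed.

Lemma cvgC_B u v l m : cvgC u l -> cvgC v m -> cvgC (fun n => u n - v n) (l - m).
Proof. by move=> ul vm; apply: cvgC_D ul (cvgC_N vm). Qed.

Lemma cvgC_M u v l m : cvgC u l -> cvgC v m -> cvgC (fun n => u n * v n) (l * m).
Proof.
move=> ul vm; pose a n := nc (u n - l); pose b n := nc (v n - m).
have : (a n * b n + nc l * b n + a n * nc m) @[n --> \oo] --> (0 : R).
  rewrite -[X in _ --> X](_ : 0 * 0 + nc l * 0 + 0 * nc m = 0); last first.
    by rewrite !(mulr0, mul0r, addr0).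
  apply: cvgD; first by apply: cvgD; [exact: cvgM|apply: cvgM => //; exact: cvg_cst].
  by apply: cvgM => //; exact: cvg_cst.
apply: cvgC_le => n; rewrite /a /b -!ncM.
have -> : u n * v n - l * m = (u n - l) * (v n - m) + l * (v n - m) + (u n - l) * m.
  by ring.
by rewrite (le_trans (ncD _ _)) // lerD2r ncD.
Qed.

Lemma cvgC_nc u l : cvgC u l -> nc (u n) @[n --> \oo] --> nc l.
Proof.
move=> ul; apply/subr_cvg0; apply: cvg0_le ul => n; exact: ler_nc_dist.
Qed.

Lemma cvgC_unique u l m : cvgC u l -> cvgC u m -> l = m.
Proof.
move=> ul um; have := cvgC_nc (cvgC_B ul um).
under eq_fun do rewrite subrr Normc.normc0.
move/(cvg_unique _ (@cvg_cst _ _ _ _ _)) => /(_ (@norm_hausdorff _ _)) h.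
by apply/eqP; rewrite -subr_eq0; apply/eqP/Normc.eq0_normc; rewrite -h.
Qed.

Lemma cvgC_bound u l B : cvgC u l -> (forall n, nc (u n) <= B) -> nc l <= B.
Proof.
move=> /cvgC_nc ul uB; rewrite -(cvg_lim (@norm_hausdorff _ _) ul).
apply: limr_le; first by apply/cvg_ex; exists (nc l).
by near=> n; exact: uB.
Unshelve. all: by end_near. Qed.

Lemma cvgC_shift u l k : cvgC u l -> cvgC (fun n => u (n + k)%N) l.
Proof. by rewrite /cvgC => h; have := h; rewrite -(cvg_shiftn k). Qed.

(** The bound is an explicit parameter because Newman's argument tracks bounds that do not depend on
    the point z. *)
Definition bsum u B := forall N, \sum_(k < N) nc (u k) <= B.

(** Convergence of complex sequences is measured by a real norm, so the limits are taken on real and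
    imaginary parts; the value is meaningful under a [bsum] bound. *)
Definition csum u : R[i] :=
  Complex (limn (fun n => \sum_(k < n) complex.Re (u k)))
          (limn (fun n => \sum_(k < n) complex.Im (u k))).

Lemma abs_sum_cvg (a b : nat -> R) B : (forall n, `|a n| <= b n) ->
    (forall N, \sum_(k < N) b k <= B) ->
  cvgn (fun n => \sum_(k < n) a k).
Proof.
move=> ab bB; suff : cvgn (series a).
  rewrite (_ : series a = (fun n => \sum_(k < n) a k)) //.
  by apply/funext => n; rewrite /series /= big_mkord.
apply: normed_cvg; apply: nondecreasing_is_cvgn.
  by apply: nondecreasing_series => n _ _; exact: normr_ge0.
exists B => _ [N _ <-] /=; apply: le_trans (bB N).
by rewrite /series /= big_mkord; apply: ler_sum.
Qed.

Lemma csumP u B : bsum u B -> cvgC (fun n => \sum_(k < n) u k) (csum u).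
Proof.
move=> uB.
have c1 := abs_sum_cvg (fun n => normr_Re (u n)) uB.
have c2 := abs_sum_cvg (fun n => normr_Im (u n)) uB.
have RE (n : nat) : complex.Re (\sum_(k < n) u k) = \sum_(k < n) complex.Re (u k).
  exact: (raddf_sum (@complex.Re R : {additive Rcomplex R -> R})).
have IM (n : nat) : complex.Im (\sum_(k < n) u k) = \sum_(k < n) complex.Im (u k).
  exact: (raddf_sum (@complex.Im R : {additive Rcomplex R -> R})).
pose d1 n := \sum_(k < n) complex.Re (u k) - complex.Re (csum u).
pose d2 n := \sum_(k < n) complex.Im (u k) - complex.Im (csum u).
apply: (@cvgC_le _ _ (fun n => `|d1 n| + `|d2 n|)).
  move=> n; apply: le_trans (nc_le_ReIm _) _.
  by rewrite /d1 /d2 -RE -IM; case: (\sum_(k < n) u k).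
rewrite -(addr0 (0 : R)); apply: cvgD.
  by apply/norm_cvg0P/subr_cvg0.
by apply/norm_cvg0P/subr_cvg0.
Qed.

Lemma bsum_ge0 u B : bsum u B -> 0 <= B.
Proof. by move=> /(_ 0%N); rewrite big_ord0. Qed.

Lemma bsumW u v B : bsum v B -> (forall n, nc (u n) <= nc (v n)) -> bsum u B.
Proof. by move=> vB uv N; apply: le_trans (vB N); apply: ler_sum. Qed.

Lemma nc_csum u B : bsum u B -> nc (csum u) <= B.
Proof.
move=> uB; apply: (cvgC_bound (csumP uB)) => n.
exact: le_trans (nc_sum _ _ _) (uB n).
Qed.

Lemma bsum_conv u v B B' : bsum u B -> bsum v B' -> bsum (conv u v) (B * B').
Proof.
move=> uB vB [|N].
  by rewrite big_ord0 mulr_ge0 ?(bsum_ge0 uB) ?(bsum_ge0 vB).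
pose nu n : R := nc (u n); pose nv n : R := nc (v n).
have : \sum_(k < N.+1) nc (conv u v k) <= psum (conv nu nv) N.
  apply: ler_sum => n _; apply: le_trans (nc_sum _ _ _) _.
  by apply: ler_sum => i _; rewrite ncM.
move/le_trans; apply; rewrite psum_conv.
apply: (@le_trans _ _ (psum nu N * B')).
  rewrite /psum mulr_suml; apply: ler_sum => i _.
  by rewrite ler_wpM2l ?nc_ge0 //; exact: vB.
by rewrite ler_wpM2r ?(bsum_ge0 vB) //; exact: uB.
Qed.

(** Mertens' theorem on Cauchy products: [psum (conv u v)] is [conv u (psum v)], and replacing
    [psum v] by its limit costs the convolution of the summable [u] with a null sequence. *)
Lemma csum_conv u v B B' : bsum u B -> bsum v B' ->
  csum (conv u v) = csum u * csum v.
Proof.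
move=> uB vB.
have cv : cvgC (psum v) (csum v).
  by apply: eq_cvgC (cvgC_shift 1 (csumP vB)) => n; rewrite addn1.
have cu : cvgC (psum u) (csum u).
  by apply: eq_cvgC (cvgC_shift 1 (csumP uB)) => n; rewrite addn1.
have cw : cvgC (psum (conv u v)) (csum (conv u v)).
  by apply: eq_cvgC (cvgC_shift 1 (csumP (bsum_conv uB vB))) => n; rewrite addn1.
apply: (cvgC_unique cw).
have c2 : cvgC (fun n => conv u (fun k => psum v k - csum v) n) 0.
  pose nu n : R := nc (u n); pose d n : R := nc (psum v n - csum v).
  apply: (@cvgC_le _ _ (conv nu d)).
    move=> n; rewrite subr0 (le_trans (nc_sum _ _ _)) //.
    by apply: ler_sum => i _; rewrite ncM.
  by apply: (@conv_cvg0 _ _ _ B) => // n; exact: nc_ge0.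
have c3 : cvgC (fun n => psum u n * csum v) (csum u * csum v).
  by apply: cvgC_M cu _; apply: cvgC_cst.
have := cvgC_D c2 c3; rewrite add0r; apply: eq_cvgC => n.
rewrite psum_conv convDr; rewrite [X in _ + X + _ = _](_ : _ = - (psum u n * csum v)).
  by rewrite subrK.
by rewrite /conv mulr_suml -sumrN; apply: eq_bigr => i _; rewrite mulrN.
Qed.

Lemma eq_csum u v : u =1 v -> csum u = csum v.
Proof. by move=> /funext ->. Qed.

Lemma csum_delta : csum (fun n => (n == 0%N)%:R) = 1.
Proof.
have h : bsum (fun n => (n == 0%N)%:R) 1.
  case=> [|N]; first by rewrite big_ord0.
  rewrite big_ord_recl /= big1 ?addr0 => [|i _]; last exact: Normc.normc0.
  by rewrite -[X in X <= _]/(nc 1) Normc.normc1.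
apply: cvgC_unique (cvgC_shift 1 (csumP h)) _.
apply: eq_cvgC (cvgC_cst 1) => n /=.
by rewrite addn1 big_ord_recl /= big1 ?addr0.
Qed.

End ComplexSequences.

(** * Absolute convergence of the inverse of a power series *)

Section AbsoluteConvergenceOfTheInverse.
Variable R : realType.
Implicit Types (u v phi b : nat -> R[i]) (w z : R[i]) (r A B : R).

(** X^n - 1 splits and is separable, so it has n distinct roots, and a group of n roots of unity in
    a field is cyclic. *)
Lemma primitive_root_complex (n : nat) : (0 < n)%N -> exists z : R[i], n.-primitive_root z.
Proof.
move=> n_gt0; have [s Ds] := closed_field_poly_normal ('X^n - 1 : {poly R[i]}).
rewrite (monicP (monicXnsubC 1 n_gt0)) scale1r in Ds.
have s_unity : all n.-unity_root s.
  by apply/allP => z; rewrite -root_prod_XsubC -Ds.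
have s_size : (n < (size s).+1)%N.
  by rewrite -(size_prod_XsubC s id) -Ds size_XnsubC.
have s_uniq : uniq s.
  by rewrite -separable_prod_XsubC -Ds separable_Xn_sub_1 // pnatr_eq0 -lt0n.
by have /hasP[z _ hz] := has_prim_root n_gt0 s_unity s_uniq s_size; exists z.
Qed.

Lemma nc_unity_root (L : nat) z : (0 < L)%N -> z ^+ L = 1 -> nc z = 1.
Proof.
move=> L0 zL; apply/eqP; rewrite -(@pexpr_eq1 _ _ L) ?nc_ge0 //.
by rewrite -ncX zL Normc.normc1.
Qed.

Lemma sqr_nc_conj z : ((nc z) ^+ 2)%:C%C = z * z^*%C.
Proof. by rewrite rmorphXn -sqr_normc. Qed.

(** Orthogonality of the L-th roots of unity, a finite substitute for integrating a squared modulus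
    over the circle. *)
Lemma parseval_roots (L : nat) zeta u : L.-primitive_root zeta ->
  \sum_(j < L) nc (\sum_(k < L) u k * (zeta ^+ j) ^+ k) ^+ 2 =
  L%:R * \sum_(k < L) nc (u k) ^+ 2.
Proof.
move=> prim; have L0 := prim_order_gt0 prim.
have z1 : nc zeta = 1 by apply: nc_unity_root (prim_expr_order prim).
have zzJ : zeta * zeta^*%C = 1 by rewrite -sqr_nc_conj z1 expr1n.
apply: (@complexI R); rewrite rmorphM !rmorph_sum /=.
under eq_bigr do rewrite sqr_nc_conj rmorph_sum /= big_distrlr /=.
under [in RHS]eq_bigr do rewrite sqr_nc_conj.
rewrite exchange_big /= mulr_sumr; apply: eq_bigr => k _.
rewrite exchange_big /=.
have E (l : 'I_L) : \sum_(j < L) u k * (zeta ^+ j) ^+ k * (u l * (zeta ^+ j) ^+ l)^*%C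
    = u k * (u l)^*%C * \sum_(j < L) (zeta ^+ k * zeta^*%C ^+ l) ^+ j.
  rewrite mulr_sumr; apply: eq_bigr => j _.
  rewrite rmorphM !rmorphXn /= mulrACA exprMn -!exprM.
  by rewrite (mulnC k) (mulnC l).
rewrite (bigD1 k) //= [X in _ + X]big1 ?addr0 => [|l lk].
  rewrite E -exprMn zzJ expr1n.
  under eq_bigr do rewrite expr1n.
  by rewrite sumr_const card_ord rmorph_nat mulrC.
rewrite E; set eta := zeta ^+ k * _.
have etaL : eta ^+ L = 1.
  have zJL : zeta^*%C ^+ L = 1.
    by rewrite -rmorphXn /= (prim_expr_order prim) rmorph1.
  rewrite /eta exprMn -!exprM (mulnC k) (mulnC l) !exprM.
  by rewrite (prim_expr_order prim) zJL !expr1n mulr1.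
(* Here [eta] is zeta^(k - l) with k and l distinct modulo L, so its geometric sum over a full
   period vanishes. *)
have eta1 : eta - 1 != 0.
  rewrite subr_eq0; apply: contra lk => /eqP h.
  have : zeta ^+ k = zeta ^+ l.
    by rewrite -[RHS]mul1r -h /eta -mulrA -exprMn (mulrC _ zeta) zzJ expr1n mulr1.
  move/eqP; rewrite (eq_prim_root_expr prim) !modn_small // => /eqP kl.
  by apply/eqP/val_inj.
have := subrX1 eta L; rewrite etaL subrr => /esym/eqP.
by rewrite mulf_eq0 (negPf eta1) /= => /eqP ->; rewrite mulr0.
Qed.

(** Truncate at a length L beyond which the tail is at most d: on the L-th roots of unity the
    truncation is bounded by A + d, and [parseval_roots] applies. *)
Lemma parseval_le u A B : bsum u B ->
    (forall w, nc w = 1 -> nc (csum (fun k => u k * w ^+ k)) <= A) ->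
  forall K, \sum_(k < K) nc (u k) ^+ 2 <= A ^+ 2.
Proof.
move=> uB uA K.
have A0 : 0 <= A by apply: le_trans (uA 1 (Normc.normc1 _)); exact: nc_ge0.
apply/ler_addgt0Pr => e e0.
have [d d0 dA] : exists2 d : R, 0 < d & (A + d) ^+ 2 <= A ^+ 2 + e.
  (* With d <= 1 one has 2 A d + d^2 <= d (2 A + 1) <= e. *)
  exists (Num.min 1 (e / (2 * A + 1))).
    by rewrite lt_min ltr01 divr_gt0 // ltr_wpDl // mulr_ge0.
  set d := Num.min _ _; have d1 : d <= 1 by rewrite ge_min lexx.
  have d0 : 0 <= d by rewrite le_min ler01 divr_ge0 ?ltW // ltr_wpDl // mulr_ge0.
  have : d * (2 * A + 1) <= e.
    by rewrite -ler_pdivlMr ?ge_min ?lexx ?orbT // ltr_wpDl // mulr_ge0.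
  by nra.
have [M HM] := sum_tail_le (fun k => nc_ge0 (u k)) uB d0.
pose L := maxn K M.+1; have L0 : (0 < L)%N by rewrite /L leq_max orbT.
have [zeta prim] := primitive_root_complex L0.
have tail w : nc w = 1 ->
    nc (\sum_(k < L) u k * w ^+ k - csum (fun k => u k * w ^+ k)) <= d.
  move=> w1; have wB : bsum (fun k => u k * w ^+ k) B.
    by move=> N; under eq_bigr do rewrite ncM ncX w1 expr1n mulr1.
  pose s := \sum_(k < L) u k * w ^+ k.
  have := cvgC_B (cvgC_cst s) (cvgC_shift L (csumP wB)).
  move/cvgC_bound; apply => n; rewrite /s.
  rewrite -ncN opprB -!(big_mkord predT (fun k => u k * w ^+ k)).
  rewrite (big_cat_nat (leq0n L) (leq_addl n L)) /= addrAC subrr add0r.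
  apply: le_trans (nc_sum _ _ _) _; apply: le_trans (HM (n + L)%N).
  rewrite [leRHS](@big_cat_nat _ _ _ L) //=; last 2 first.
  - by rewrite /L leq_max leqnSn orbT.
  - exact: leq_addl.
  rewrite ler_wpDl ?sumr_ge0 // => [k _|]; first exact: nc_ge0.
  by apply: ler_sum => k _; rewrite ncM ncX w1 expr1n mulr1.
apply: le_trans dA.
have : \sum_(j < L) nc (\sum_(k < L) u k * (zeta ^+ j) ^+ k) ^+ 2 <= L%:R * (A + d) ^+ 2.
  rewrite -[L in L%:R]card_ord -sumr_const mulr_suml; apply: ler_sum => j _.
  rewrite mul1r ler_pXn2r ?nnegrE ?nc_ge0 ?(addr_ge0 A0 (ltW d0)) //.
  have w1 : nc (zeta ^+ j) = 1.
    by rewrite ncX (nc_unity_root L0 (prim_expr_order prim)) expr1n.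
  rewrite -(subrK (csum (fun k => u k * (zeta ^+ j) ^+ k)) (\sum_(k < L) _)).
  by rewrite (le_trans (ncD _ _)) // addrC lerD // ?uA ?tail.
rewrite (parseval_roots u prim) ler_pM2l ?ltr0n //; apply: le_trans.
rewrite -!(big_mkord predT (fun k => nc (u k) ^+ 2)).
rewrite [leRHS](@big_cat_nat _ _ _ K) //= ?leq_maxl //.
by rewrite lerDl sumr_ge0 // => k _; rewrite exprn_ge0 ?nc_ge0.
Qed.

Lemma bernoulli_ge (t : R) n : 0 <= t -> t <= 1 -> 1 - n%:R * t <= (1 - t) ^+ n.
Proof.
move=> t0 t1; elim: n => [|n IH]; first by rewrite mul0r subr0.
have p0 : 0 <= (1 - t) ^+ n by rewrite exprn_ge0 // subr_ge0.
have p1 : (1 - t) ^+ n <= 1 by rewrite exprn_ile1 // ?subr_ge0 // lerBlDr lerDl.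
by rewrite exprS -natr1; nra.
Qed.

(** The strengthened bound 2 - 1/n is inductive, because 1/(n+1)^2 is at most 1/n - 1/(n+1). *)
Lemma sum_inv_sqr_le n : \sum_(k < n) (k.+1%:R ^- 2 : R) <= 2.
Proof.
suff H m : \sum_(k < m.+1) (k.+1%:R ^- 2 : R) <= 2 - m.+1%:R^-1.
  case: n => [|n]; first by rewrite big_ord0.
  by apply: le_trans (H n) _; rewrite lerBlDr lerDl invr_ge0.
elim: m => [|m IH]; first by rewrite big_ord1 invr1 expr1n invr1; lra.
rewrite big_ord_recr /=; apply: le_trans (lerD IH (lexx _)) _.
have h : (m.+2%:R : R) = m.+1%:R + 1 by rewrite natr1.
have h0 : (0 : R) < m.+1%:R by rewrite ltr0n.
rewrite h; move: (m.+1%:R : R) h0 => x x0.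
have x1 : 0 < x + 1 by rewrite addr_gt0.
rewrite -subr_ge0.
have -> : 2 - (x + 1)^-1 - (2 - x^-1 + (x + 1) ^- 2) = (x * (x + 1) ^+ 2)^-1.
  by field; rewrite !gt_eqF.
by rewrite invr_ge0 mulr_ge0 ?exprn_ge0 // ltW.
Qed.

(** The factor 1 gives the terms the shape that [conv_twist] expects. *)
Lemma bsum_geometric r : 0 <= r -> r < 1 ->
  bsum (fun n => 1 * r%:C%C ^+ n) (1 - r)^-1.
Proof.
move=> r0 r1 N; under eq_bigr do rewrite mul1r ncX nc_real_ge0 //.
exact: geometric_psum_le.
Qed.

(** The cube of the geometric series has coefficients (n+1)(n+2)/2, and twice that dominates
    (n+1)^2. *)
Lemma bsum_poly2_geometric r : 0 <= r -> r < 1 ->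
  exists B, forall N, \sum_(n < N) (n.+1 * n.+1)%:R * r ^+ n <= B.
Proof.
move=> r0 r1; have g := bsum_geometric r0 r1.
have g3 := bsum_conv g (bsum_conv g g).
exists (2 * ((1 - r)^-1 * ((1 - r)^-1 * (1 - r)^-1))) => N.
have := g3 N; rewrite -(@ler_pM2l _ 2) //; apply: le_trans.
rewrite mulr_sumr; apply: ler_sum => n _.
have -> : conv (fun n => 1 * r%:C%C ^+ n)
  (conv (fun n => 1 * r%:C%C ^+ n) (fun n => 1 * r%:C%C ^+ n)) n
  = (\sum_(i < n.+1) i.+1)%:R * r%:C%C ^+ n.
  rewrite (eq_conv (fun=> erefl) (conv_twist _ _ _)) conv_twist; congr (_ * _).
  rewrite convC conv1 /psum natr_sum; apply: eq_bigr => i _.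
  by rewrite conv1 /psum sumr_const card_ord.
rewrite ncM ncX nc_real_ge0 // -(rmorph_nat (@real_complex R)) nc_real_ge0 //.
rewrite mulrA ler_wpM2r ?exprn_ge0 // -natrM ler_nat.
elim: (val n) => [|m IH]; first by rewrite big_ord1.
by rewrite big_ord_recr /=; move: (bigop.body _ _ _) IH => S; nia.
Qed.

Lemma bsum_twist_le1 u z B : bsum u B -> nc z <= 1 -> bsum (fun n => u n * z ^+ n) B.
Proof.
move=> uB z1; apply: (bsumW uB) => n; rewrite ncM ncX.
by rewrite ler_piMr ?nc_ge0 // exprn_ile1 ?nc_ge0.
Qed.

(* Newman's argument: Parseval bounds the coefficients of the derivative of
   1 / phi in l^2, uniformly on circles approaching the unit circle. *)
Lemma inverse_bsum phi b (C0 C1 D delta : R) :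
    bsum phi C0 -> bsum (fun n => n%:R * phi n) C1 ->
    (forall n, conv phi b n = (n == 0%N)%:R) ->
    (forall n, nc (b n) <= D * n.+1%:R) -> 0 < delta ->
    (forall z, nc z < 1 -> delta <= nc (csum (fun n => phi n * z ^+ n))) ->
  exists B, bsum b B.
Proof.
move=> phiB phi'B inv bD delta0 phi_ge.
pose phi' n := n%:R * phi n; pose b' n := n%:R * b n.
(* Coefficient form of (1/phi)' = - phi' / phi^2, with z d/dz as derivation so that indices do not
   shift: derive phi b = 1, then multiply by b. *)
have b'E : b' =1 (fun n => - conv b (conv phi' b) n).
  move=> n; have h m : conv phi b' m = - conv phi' b m.
    apply/eqP; rewrite -addr_eq0 -big_split /=; apply/eqP.
    transitivity (m%:R * conv phi b m); last first.
      by rewrite inv; case: m => [|m]; rewrite ?mul0r ?mulr0.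
    rewrite /conv mulr_sumr; apply: eq_bigr => i _.
    have mE : m%:R = i%:R + (m - i)%:R :> R[i].
      by rewrite -natrD subnKC // -ltnS.
    by rewrite /b' /phi' mE; ring.
  transitivity (conv b (conv phi b') n).
    rewrite convA (eq_conv (convC _ _) (fun=> erefl)) (eq_conv inv (fun=> erefl)).
    by rewrite convC conv_delta.
  by rewrite (eq_conv (fun=> erefl) h) /conv -sumrN; apply: eq_bigr => i _; rewrite mulrN.
have D0 : 0 <= D by have := bD 0%N; rewrite mulr1; apply: le_trans; exact: nc_ge0.
(* Linear growth of [b] makes both series converge in the open disc. These bounds depend on z and
   only license the product formulas. *)
have bB z : nc z < 1 -> exists B,
    bsum (fun n => b n * z ^+ n) B /\ bsum (fun n => b' n * z ^+ n) B.
  move=> z1; have [B HB] := bsum_poly2_geometric (nc_ge0 z) z1.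
  exists (D * B); split=> N; apply: le_trans (ler_wpM2l D0 (HB N));
      rewrite mulr_sumr; apply: ler_sum => n _; rewrite ncM ncX mulrA;
      rewrite ler_wpM2r ?exprn_ge0 ?nc_ge0 //.
    apply: le_trans (bD _) _; rewrite ler_wpM2l // ler_nat; lia.
  rewrite /b' ncM -(rmorph_nat (@real_complex R)) nc_real_ge0 //.
  apply: le_trans (ler_wpM2l _ (bD _)) _; rewrite // mulrCA ler_wpM2l //.
  by rewrite -natrM ler_nat; lia.
have b_le z : nc z < 1 -> nc (csum (fun n => b' n * z ^+ n)) <= C1 / delta ^+ 2.
  move=> z1; have [B [HB HB']] := bB z z1.
  have pB := bsum_twist_le1 phiB (ltW z1); have p'B := bsum_twist_le1 phi'B (ltW z1).
  set sb := csum (fun n => b n * z ^+ n).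
  have sb_le : nc sb <= delta^-1.
    have : csum (conv (fun n => phi n * z ^+ n) (fun n => b n * z ^+ n)) = 1.
      rewrite -csum_delta; apply: eq_csum => n; rewrite conv_twist inv.
      by case: n => [|n]; rewrite ?mulr1 ?mul0r.
    rewrite (csum_conv pB HB) -/sb => h.
    have := Normc.normc1 R; rewrite -[1%C]/(1 : R[i]) -h ncM => h1.
    rewrite -[leRHS]mul1r ler_pdivlMr // -h1 mulrC ler_wpM2r ?nc_ge0 //.
    exact: phi_ge.
  have -> : csum (fun n => b' n * z ^+ n)
      = csum (conv (fun n => - (b n * z ^+ n))
         (conv (fun n => phi' n * z ^+ n) (fun n => b n * z ^+ n))).
    apply: eq_csum => n; rewrite convNl b'E mulNr.
    by rewrite (eq_conv (fun=> erefl) (conv_twist _ _ _)) conv_twist.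
  have nB : bsum (fun n => - (b n * z ^+ n)) B.
    by apply: (bsumW HB) => n; rewrite ncN.
  rewrite (csum_conv nB (bsum_conv p'B HB)) (csum_conv p'B HB) -/sb.
  have -> : csum (fun n => - (b n * z ^+ n)) = - sb.
    apply: cvgC_unique (csumP nB) _.
    by apply: eq_cvgC (cvgC_N (csumP HB)) => n; rewrite sumrN.
  rewrite !ncM ncN expr2 invfM mulrCA.
  rewrite ler_pM ?mulr_ge0 ?nc_ge0 //.
    exact: (nc_csum p'B).
  by rewrite ler_pM ?nc_ge0.
pose A := C1 / delta ^+ 2.
have sq r : 0 <= r -> r < 1 ->
    forall K, \sum_(k < K) nc (b' k * r%:C%C ^+ k) ^+ 2 <= A ^+ 2.
  move=> r0 r1; have rr : nc r%:C%C < 1 by rewrite nc_real_ge0.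
  have [B [_ HB]] := bB _ rr; apply: (parseval_le HB) => w w1.
  rewrite (_ : csum _ = csum (fun n => b' n * (r%:C%C * w) ^+ n)).
    by apply: b_le; rewrite ncM w1 mulr1.
  by apply: eq_csum => k; rewrite exprMn mulrA.
have sq1 K : \sum_(k < K) (k%:R * nc (b k)) ^+ 2 <= 2 * A ^+ 2.
  (* By Bernoulli r^(2K) >= 1 - 2K / (4K + 2) >= 1/2, so replacing the radius r by 1 costs a factor
     2. The radius depends on K, but A does not. *)
  pose t : R := (4 * K%:R + 2)^-1; pose r := 1 - t.
  have K0 : (0 : R) <= K%:R by [].
  have d0 : (0 : R) < 4 * K%:R + 2 by lra.
  have t0 : 0 < t by rewrite invr_gt0.
  have tE : t * (4 * K%:R + 2) = 1 by rewrite mulVf ?gt_eqF.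
  have t1 : t <= 2^-1 by nra.
  have r_gt0 : 0 < r by rewrite /r; lra.
  have r0 := ltW r_gt0; have r1 : r < 1 by rewrite ltrBlDr ltrDl.
  have rK : 2^-1 <= r ^+ (K * 2).
    apply: le_trans (bernoulli_ge (K * 2) (ltW t0) _); rewrite ?natrM; nra.
  have := sq r r0 r1 K; rewrite -(@ler_pM2l _ 2) //; apply: le_trans.
  rewrite mulr_sumr; apply: ler_sum => k _.
  have -> : nc (b' k * r%:C%C ^+ k) = k%:R * nc (b k) * r ^+ k.
    rewrite /b' !ncM ncX (nc_real_ge0 r0).
    by rewrite -(rmorph_nat (@real_complex R)) nc_real_ge0.
  rewrite [in leRHS]exprMn -exprM.
  have : 2^-1 <= r ^+ (k * 2).
    apply: le_trans rK _; rewrite ler_wiXn2l ?(ltW r1) //.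
    by have := ltn_ord k; lia.
  have := sqr_ge0 (k%:R * nc (b k)); move: (r ^+ _) (_ ^+ 2) => x y; nra.
(* With x = k and y = |b k|, the inequality 2 y <= (x y)^2 + x^-2 turns the l^2 bound on k b(k) into
   an l^1 bound on b; the index 0 is set aside. *)
exists (nc (b 0%N) + (2 * A ^+ 2 + 2)) => -[|N].
  by rewrite big_ord0; have := nc_ge0 (b 0%N); have := sqr_ge0 A; lra.
rewrite big_ord_recl lerD2l.
have := lerD (sq1 N.+1) (sum_inv_sqr_le N); rewrite big_ord_recl /= mul0r expr0n /=.
rewrite add0r -big_split /=; apply: le_trans; apply: ler_sum => k _.
rewrite /bump /= add1n; have k0 : (0 : R) < k.+1%:R by rewrite ltr0n.
have n0 := nc_ge0 (b k.+1); move: (k.+1%:R : R) (nc _) k0 n0 => x y x0 y0.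
have := sqr_ge0 (x * y - x^-1).
have -> : (x * y - x^-1) ^+ 2 = (x * y) ^+ 2 + x ^- 2 - 2 * y.
  by field; rewrite gt_eqF.
by rewrite subr_ge0; lra.
Qed.

End AbsoluteConvergenceOfTheInverse.

(** * Nonvanishing on the unit circle *)

Section NonVanishing.
Variable R : realType.
Implicit Types (u v phi m : nat -> R[i]) (w z : R[i]) (r x t A B : R).

(* Logarithmic derivative of the 3-4-1 product below; the polynomial has
   nonnegative coefficients in the Bernstein basis of degree 4 in [x]. *)
Lemma poisson_341 x t : 0 <= x -> x <= 1 -> 0 <= t -> t <= 2 ->
  0 <= 8 * (1 - x) ^+ 4 + (1 - x) ^+ 2 *
         (t * (12 * x - 4) + 2 * t * (2 - t) * (15 * x - 1))
       + 2 * x * t * (2 * t * (2 - t)) * (11 * x - 5).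
Proof.
move=> x0 x1 t0 t2; pose v := 2 - t; pose m := 1 - x.
have v0 : 0 <= v by rewrite /v; lra.
have m0 : 0 <= m by rewrite /m; lra.
(* Both quadratics in [v] have negative discriminant; the hint completes the square. *)
have p1 : 0 <= 20 * v ^+ 2 - 14 * v + 4.
  by have := sqr_ge0 (20 * v - 7); nra.
have p2 : 0 <= 16 * v ^+ 2 - 4 * v + 8.
  by have := sqr_ge0 (16 * v - 2); nra.
have -> : 8 * (1 - x) ^+ 4 + (1 - x) ^+ 2 *
         (t * (12 * x - 4) + 2 * t * (2 - t) * (15 * x - 1))
       + 2 * x * t * (2 * t * (2 - t)) * (11 * x - 5)
  = 2 * v ^+ 2 * m ^+ 4 + t * (20 * v ^+ 2 - 14 * v + 4) * (x * m ^+ 3)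
    + t * (16 * v ^+ 2 - 4 * v + 8) * (x ^+ 2 * m ^+ 2)
    + 28 * (t ^+ 2 * v) * (x ^+ 3 * m) + 24 * (t ^+ 2 * v) * x ^+ 4.
  by rewrite /v /m; ring.
by rewrite !addr_ge0 // !mulr_ge0 // ?exprn_ge0 // mulr_ge0 // exprn_ge0.
Qed.

(** With C = cos theta and 2 C^2 - 1 = cos (2 theta), the left side is the square of the 3-4-1
    product at radius x. It equals 1 at x = 0 and decreases: its derivative is minus a nonnegative
    factor times the polynomial of [poisson_341] at t = 1 - C. *)
Lemma product_341_real x (C : R) : 0 <= x -> x <= 1 -> -1 <= C -> C <= 1 ->
  (1 - x) ^+ 6 * (1 - 2 * x * C + x ^+ 2) ^+ 4 *
    (1 - 2 * x * (2 * C ^+ 2 - 1) + x ^+ 2) <= 1.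
Proof.
move=> x0 x1 C0 C1.
pose p : {poly R} := (1%:P - 'X) ^+ 6 * (1%:P - (2 * C)%:P * 'X + 'X ^+ 2) ^+ 4 *
  (1%:P - (2 * (2 * C ^+ 2 - 1))%:P * 'X + 'X ^+ 2).
have horner1 y : (1 : {poly R}).[y] = 1 by rewrite -polyC1 hornerC.
have pE y : p.[y] = (1 - y) ^+ 6 * (1 - 2 * y * C + y ^+ 2) ^+ 4 *
    (1 - 2 * y * (2 * C ^+ 2 - 1) + y ^+ 2).
  rewrite /p !(hornerM, horner_exp, hornerD, hornerN, hornerZ, hornerMn, hornerX).
  by rewrite !(hornerC, horner0, horner1); ring.
rewrite -pE; have -> : 1 = p.[0] by rewrite pE; ring.
have [->//|xn0] := eqVneq x 0.
have xgt0 : 0 < x by rewrite lt_def xn0.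
have [y yI E] := poly_mvt p xgt0.
rewrite -subr_le0 E subr0 mulr_le0_ge0 //.
have /andP[y0 y1] : (0 < y) && (y < x) by move: yI; rewrite in_itv.
have yx1 : y <= 1 by lra.
have -> : p^`().[y] = - (2 * ((1 - y) ^+ 5 * (1 - 2 * y * C + y ^+ 2) ^+ 3 *
    (8 * (1 - y) ^+ 4 + (1 - y) ^+ 2 * ((1 - C) * (12 * y - 4) +
        2 * (1 - C) * (2 - (1 - C)) * (15 * y - 1))
     + 2 * y * (1 - C) * (2 * (1 - C) * (2 - (1 - C))) * (11 * y - 5)))).
  rewrite /p !(derivM, derivD, derivN, derivX, derivC, deriv_exp).
  rewrite !(hornerM, horner_exp, hornerD, hornerN, hornerZ, hornerMn, hornerX) /=.
  by rewrite !(hornerC, horner0, horner1) /=; ring.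
rewrite oppr_le0 mulr_ge0 // mulr_ge0 //; last by apply: poisson_341; lra.
rewrite mulr_ge0 // exprn_ge0 //; first by lra.
have -> : 1 - 2 * y * C + y ^+ 2 = (1 - y) ^+ 2 + 2 * y * (1 - C) by ring.
by rewrite addr_ge0 ?sqr_ge0 // !mulr_ge0 ?subr_ge0 // ltW.
Qed.

Lemma sqr_nc_1B x w : nc w = 1 ->
  nc (1 - x%:C%C * w) ^+ 2 = 1 - 2 * x * complex.Re w + x ^+ 2.
Proof.
move=> w1; have := sqr_nc w; rewrite w1 expr1n sqr_nc.
by case: w {w1} => a b /= h; nra.
Qed.

(** The 3-4-1 inequality for one factor of 1/Z. Proving it factor by factor avoids the logarithm of
    the Euler product. *)
Lemma product_341 x w : 0 <= x -> x <= 1 -> nc w = 1 ->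
  nc (1 - x%:C%C) ^+ 3 * nc (1 - x%:C%C * w) ^+ 4 * nc (1 - x%:C%C * w ^+ 2) <= 1.
Proof.
move=> x0 x1 w1; have w21 : nc (w ^+ 2) = 1 by rewrite ncX w1 expr1n.
have := sqr_nc w; rewrite w1 expr1n => wRI.
have C1 : `|complex.Re w| <= 1 by rewrite -w1 normr_Re.
have := product_341_real x0 x1; move/(_ (complex.Re w)).
move: C1; rewrite ler_norml => /andP[C1 C2] /(_ C1 C2) H.
have Re2 : complex.Re (w ^+ 2) = 2 * complex.Re w ^+ 2 - 1.
  by move: wRI; case: w {w1 w21 C1 C2 H} => a b /= h; rewrite expr2 /=; nra.
rewrite -(@ler_pXn2r _ 2) ?nnegrE ?mulr_ge0 ?exprn_ge0 ?nc_ge0 // expr1n.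
apply: le_trans H.
set X := nc _; set Y := nc _; set Z := nc _.
have -> : (X ^+ 3 * Y ^+ 4 * Z) ^+ 2 = X ^+ 6 * (Y ^+ 2) ^+ 4 * Z ^+ 2 by ring.
rewrite /X /Y /Z !sqr_nc_1B // Re2.
have -> : nc (1 - x%:C%C) = 1 - x.
  by rewrite -(rmorph1 (@real_complex R)) -rmorphB nc_real_ge0 // subr_ge0.
by rewrite lexx.
Qed.

Lemma le0_small (E K d : R) : 0 < d -> (forall x, 0 < x -> x <= d -> E <= K * x) -> E <= 0.
Proof.
move=> d0 H; rewrite leNgt; apply/negP => E0.
pose x := Num.min d (E / (2 * (`|K| + 1))).
have K0 : 0 < 2 * (`|K| + 1) by rewrite mulr_gt0 // ltr_wpDl.
have x0 : 0 < x by rewrite lt_min d0 divr_gt0.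
have xd : x <= d by rewrite ge_min lexx.
have : x * (2 * (`|K| + 1)) <= E by rewrite -ler_pdivlMr // ge_min lexx orbT.
have := H x x0 xd; have := ler_norm K; nra.
Qed.

Definition series_at u z : R[i] := csum (fun n => u n * z ^+ n).

Lemma nc_subX z w n : nc z <= 1 -> nc w <= 1 -> nc (z ^+ n - w ^+ n) <= n%:R * nc (z - w).
Proof.
move=> z1 w1; elim: n => [|n IH]; first by rewrite subrr Normc.normc0 mul0r.
have -> : z ^+ n.+1 - w ^+ n.+1 = z * (z ^+ n - w ^+ n) + (z - w) * w ^+ n.
  by rewrite !exprS; ring.
rewrite (le_trans (ncD _ _)) // !ncM ncX -natr1 mulrDl mul1r lerD //.
  by rewrite (le_trans _ IH) // ler_piMl ?nc_ge0.
by rewrite ler_piMr ?nc_ge0 // exprn_ile1 ?nc_ge0.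
Qed.

(** Since |z^n - w^n| <= n |z - w| on the closed disc, a bound on the sum of n |phi n| is a
    Lipschitz constant up to the boundary. *)
Lemma series_lipschitz phi (C0 C1 : R) z w :
    bsum phi C0 -> bsum (fun n => n%:R * phi n) C1 -> nc z <= 1 -> nc w <= 1 ->
  nc (series_at phi z - series_at phi w) <= C1 * nc (z - w).
Proof.
move=> h0 h1 z1 w1.
have := cvgC_B (csumP (bsum_twist_le1 h0 z1)) (csumP (bsum_twist_le1 h0 w1)).
move/cvgC_bound; apply => N; rewrite -sumrB (le_trans (nc_sum _ _ _)) //.
rewrite (le_trans _ (ler_wpM2r (nc_ge0 _) (h1 N))) // mulr_suml; apply: ler_sum => n _.
rewrite -mulrBr !ncM -(rmorph_nat (@real_complex R)) nc_real_ge0 //.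
by rewrite mulrC [leRHS]mulrAC ler_wpM2r ?nc_ge0 // nc_subX.
Qed.

Lemma series_le phi (C0 : R) z : bsum phi C0 -> nc z <= 1 -> nc (series_at phi z) <= C0.
Proof. by move=> h z1; exact: nc_csum (bsum_twist_le1 h z1). Qed.

Lemma bsum_bounded_geometric m (D : R) z : (forall n, nc (m n) <= D) -> nc z < 1 ->
  bsum (fun n => m n * z ^+ n) (D * (1 - nc z)^-1).
Proof.
move=> mD z1 N.
have D0 : 0 <= D by apply: le_trans (mD 0%N); exact: nc_ge0.
rewrite (le_trans _ (ler_wpM2l D0 (geometric_psum_le N (nc_ge0 z) z1))) //.
by rewrite mulr_sumr; apply: ler_sum => n _; rewrite ncM ncX ler_wpM2r ?exprn_ge0 ?nc_ge0.
Qed.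

(** The sequence [m] is merely bounded, which confines the identity to the open disc; boundary
    points are reached only through the continuity of the series of [phi]. *)
Lemma series_mul1B phi m (C0 D : R) z : bsum phi C0 -> (forall n, nc (m n) <= D) ->
    (forall n, conv phi m n = (n == 0%N)%:R - (n == 1%N)%:R) -> nc z < 1 ->
  series_at phi z * series_at m z = 1 - z.
Proof.
move=> h0 mD inv z1.
rewrite /series_at -(csum_conv (bsum_twist_le1 h0 (ltW z1)) (bsum_bounded_geometric mD z1)).
apply: cvgC_unique.
  (* A shift by 2 passes both nonzero coefficients of 1 - z; from there on the partial sums are
     constant. *)
  exact: cvgC_shift 2 (csumP (bsum_conv (bsum_twist_le1 h0 (ltW z1))
    (bsum_bounded_geometric mD z1))).
apply: eq_cvgC (cvgC_cst (1 - z)) => n.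
rewrite addn2; under eq_bigr do rewrite conv_twist inv.
rewrite big_ord_recl big_ord_recl /= big1 => [|i _]; last by rewrite subrr mul0r.
by rewrite /bump /= subr0 sub0r expr0 expr1 mulr1 mulN1r addr0.
Qed.

(** The odd variables stand for the moduli of the series of [phi], the even ones for those of [m],
    at r, r w and r w^2. *)
Lemma product_341_le (a1 a2 a3 a4 a5 a6 A1 A3 A5 : R) :
    0 <= a1 -> 0 <= a2 -> 0 <= a3 -> 0 <= a4 -> 0 <= a5 -> 0 <= a6 ->
    a1 <= A1 -> a3 <= A3 -> a5 <= A5 -> a2 ^+ 3 * a4 ^+ 4 * a6 <= 1 ->
  (a1 * a2) ^+ 3 * (a3 * a4) ^+ 4 * (a5 * a6) <= A1 ^+ 3 * A3 ^+ 4 * A5.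
Proof.
move=> p1 p2 p3 p4 p5 p6 h1 h3 h5 h.
have -> : (a1 * a2) ^+ 3 * (a3 * a4) ^+ 4 * (a5 * a6) =
   (a1 ^+ 3 * a3 ^+ 4 * a5) * (a2 ^+ 3 * a4 ^+ 4 * a6) by ring.
apply: (@le_trans _ _ (a1 ^+ 3 * a3 ^+ 4 * a5)).
  by rewrite ler_piMr // !mulr_ge0 ?exprn_ge0.
by rewrite !ler_pM ?mulr_ge0 ?exprn_ge0 // lerXn2r // nnegrE // ?(le_trans p1) ?(le_trans p3).
Qed.

(** Put x = 1 - r. A zero at w forces |phi(r w)| <= C1 x, so x^3 |1 - r w|^4 |1 - r w^2| is at most
    a constant times x^4. If w^2 <> 1, both distances stay away from 0 as x tends to 0, and the
    fourth power beats the third. *)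
Lemma circle_zero phi m (C0 C1 D : R) w : bsum phi C0 ->
    bsum (fun n => n%:R * phi n) C1 -> (forall n, nc (m n) <= D) ->
    (forall n, conv phi m n = (n == 0%N)%:R - (n == 1%N)%:R) ->
    (forall r, 0 <= r -> r < 1 ->
      nc (series_at m r%:C%C) ^+ 3 * nc (series_at m (r%:C%C * w)) ^+ 4 *
      nc (series_at m (r%:C%C * w ^+ 2)) <= 1) ->
  nc w = 1 -> series_at phi w = 0 -> w = 1 \/ w = -1.
Proof.
move=> h0 h1 mD inv m341 w1 Fw.
suff : w ^+ 2 == 1.
  by rewrite sqrf_eq1 => /orP[] /eqP ->; [left|right].
apply/negPn/negP => w2n1.
have wn1 : w != 1 by apply: contra w2n1 => /eqP ->; rewrite expr1n.
have w21 : nc (w ^+ 2) = 1 by rewrite ncX w1 expr1n.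
have nc_gt0 (v : R[i]) : v != 1 -> 0 < nc (1 - v).
  move=> v1; rewrite lt_def nc_ge0 andbT; apply: contra v1 => /eqP/Normc.eq0_normc/eqP.
  by rewrite subr_eq0 eq_sym.
pose p := nc (1 - w); pose s := nc (1 - w ^+ 2).
have p0 : 0 < p := nc_gt0 _ wn1; have s0 : 0 < s := nc_gt0 _ w2n1.
have C0_ge0 := bsum_ge0 h0; have C1_ge0 := bsum_ge0 h1.
suff : (p / 2) ^+ 4 * (s / 2) <= 0.
  by rewrite leNgt mulr_gt0 // ?exprn_gt0 // divr_gt0.
(* The range of x keeps r nonnegative and lets each of the distances p and s shrink by at most
   half. *)
apply: (@le0_small _ (C0 ^+ 4 * C1 ^+ 4) (Num.min (Num.min p s / 2) 1)).
  by rewrite lt_min ltr01 divr_gt0 // lt_min p0.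
move=> x x0; rewrite le_min => /andP[xps x1]; pose r := 1 - x.
have [xp xs] : x <= p / 2 /\ x <= s / 2.
  move: xps; rewrite ler_pdivlMr // le_min => /andP[? ?].
  by rewrite !ler_pdivlMr.
have r0 : 0 <= r by rewrite subr_ge0.
have r1 : r < 1 by rewrite ltrBlDr ltrDl.
have ncr (v : R[i]) : nc v = 1 -> nc (r%:C%C * v) < 1.
  by move=> v1; rewrite ncM v1 mulr1 nc_real_ge0.
have dist (v : R[i]) : nc v = 1 -> nc (r%:C%C * v - v) = x.
  move=> v1; rewrite -[X in _ - X]mul1r -mulrBl ncM v1 mulr1 nc_distC.
  by rewrite -(rmorph1 (@real_complex R)) -rmorphB nc_real_ge0 /r ?subKr // ltW.
have low (v : R[i]) : nc v = 1 -> nc (1 - v) - x <= nc (1 - r%:C%C * v).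
  move=> v1; rewrite lerBlDr -(dist v v1).
  by apply: le_trans (ncD _ _); rewrite addrA subrK.
have nc1r : nc (1 - r%:C%C) = x.
  by rewrite -(rmorph1 (@real_complex R)) -rmorphB nc_real_ge0 /r ?subKr // ltW.
have E (v : R[i]) : nc v < 1 -> nc (1 - v) = nc (series_at phi v) * nc (series_at m v).
  by move=> v1; rewrite -ncM (series_mul1B h0 mD inv).
have rr1 : nc r%:C%C < 1 by rewrite nc_real_ge0.
have Frw : nc (series_at phi (r%:C%C * w)) <= C1 * x.
  rewrite -(dist w w1) -[series_at _ _]subr0 -Fw.
  by apply: series_lipschitz h0 h1 _ _; rewrite ?w1 // ltW ?ncr.
have H : x ^+ 3 * nc (1 - r%:C%C * w) ^+ 4 * nc (1 - r%:C%C * w ^+ 2) <=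
    C0 ^+ 3 * (C1 * x) ^+ 4 * C0.
  have E1 := E _ rr1; rewrite nc1r in E1.
  rewrite [X in X ^+ 3 * nc (1 - _) ^+ 4 * _]E1 (E _ (ncr w w1)) (E _ (ncr _ w21)).
  apply: product_341_le (m341 r r0 r1) => //; try exact: nc_ge0.
  - exact: series_le h0 (ltW rr1).
  - exact: series_le h0 (ltW (ncr _ w21)).
have x3 : 0 < x ^+ 3 by rewrite exprn_gt0.
rewrite -(ler_pM2l x3).
have -> : x ^+ 3 * (C0 ^+ 4 * C1 ^+ 4 * x) = C0 ^+ 3 * (C1 * x) ^+ 4 * C0 by ring.
apply: le_trans H; rewrite -[leRHS]mulrA (ler_pM2l x3).
apply: ler_pM; rewrite ?exprn_ge0 ?divr_ge0 ?(ltW p0) ?(ltW s0) //.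
  apply: lerXn2r; rewrite ?nnegrE ?nc_ge0 ?divr_ge0 ?(ltW p0) //.
  by have := low w w1; rewrite -/p; lra.
by have := low _ w21; rewrite -/s; lra.
Qed.

(** Two successive extractions, for real parts and then for imaginary parts. Only n <= f n is
    recorded, which is all that [disc_lower_bound] needs. *)
Lemma bolzano_weierstrassC (z : nat -> R[i]) : (forall n, nc (z n) <= 1) ->
  exists2 f : nat -> nat, (forall n, (n <= f n)%N) &
    exists2 l, nc l <= 1 & cvgC (z \o f) l.
Proof.
move=> z1.
have bnd (u : nat -> R) : (forall n, `|u n| <= 1) -> bounded_fun u.
  by move=> h; exists 1; split; [exact: num_real|move=> x x1 n _; exact: le_trans (h n) (ltW x1)].
have incr (f : nat -> nat) : increasing_seq f -> forall n, (n <= f n)%N.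
  move=> /increasing_seqP h; elim=> // n IH; exact: leq_ltn_trans IH (h n).
have [f fi cf] := bolzano_weierstrass (bnd (fun n => complex.Re (z n))
  (fun n => le_trans (normr_Re _) (z1 n))).
have [g gi cg] := bolzano_weierstrass (bnd (fun n => complex.Im (z (f n)))
  (fun n => le_trans (normr_Im _) (z1 _))).
have cfg : cvgn ((fun n => complex.Re (z n)) \o f \o g).
  apply/cvg_ex; exists (limn ((fun n => complex.Re (z n)) \o f)).
  apply: (cvg_comp _ _ _ cf); apply/cvgnyPge => A; near=> n.
  by apply: leq_trans (incr g gi n); near: n; exists A.
pose l := Complex (limn ((fun n => complex.Re (z n)) \o f \o g))
                  (limn ((fun n => complex.Im (z (f n))) \o g)).
have zl : cvgC (z \o (f \o g)) l.
  pose d1 n := complex.Re (z (f (g n))) - complex.Re l.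
  pose d2 n := complex.Im (z (f (g n))) - complex.Im l.
  apply: (@cvgC_le _ _ _ (fun n => `|d1 n| + `|d2 n|)).
    by move=> n; apply: le_trans (nc_le_ReIm _) _; rewrite /d1 /d2 /=; case: (z _).
  rewrite -(addr0 (0 : R)); apply: cvgD.
    by apply/norm_cvg0P/subr_cvg0.
  by apply/norm_cvg0P/subr_cvg0.
exists (f \o g) => [n|]; first exact: leq_trans (incr g gi n) (incr f fi _).
by exists l => //; apply: (cvgC_bound zl) => n; exact: z1.
Unshelve. all: by end_near. Qed.

(** Compactness: points with values below 1/(n+1) accumulate in the closed disc, at a zero by the
    Lipschitz bound. *)
Lemma disc_lower_bound phi (C0 C1 : R) : bsum phi C0 ->
    bsum (fun n => n%:R * phi n) C1 ->
    (forall z, nc z <= 1 -> series_at phi z != 0) ->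
  exists2 delta : R, 0 < delta & forall z, nc z < 1 -> delta <= nc (series_at phi z).
Proof.
move=> h0 h1 Fn0; apply: contrapT => nex.
have /choice[z zP] : forall n, exists z, nc z < 1 /\ nc (series_at phi z) < n.+1%:R^-1.
  move=> n; apply: contrapT => nz; apply: nex; exists n.+1%:R^-1; first by rewrite invr_gt0.
  by move=> z z1; rewrite leNgt; apply/negP => h; apply: nz; exists z.
have [f fge [l l1 zl]] := bolzano_weierstrassC (fun n => ltW (zP n).1).
suff : series_at phi l = 0 by apply/eqP/Fn0.
have c1 : cvgC (fun n => series_at phi (z (f n))) (series_at phi l).
  apply: (@cvgC_le _ _ _ (fun n => C1 * nc (z (f n) - l))).
    by move=> n; apply: series_lipschitz h0 h1 _ l1; rewrite ltW // (zP _).1.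
  by rewrite -(mulr0 C1); apply: cvgMl_tmp.
apply: cvgC_unique c1 _; apply: (@cvgC_le _ _ _ (fun n => n.+1%:R^-1)); last exact: cvg_harmonic.
move=> n; rewrite subr0 (le_trans (ltW (zP _).2)) // lef_pV2 ?posrE // ler_nat ltnS.
exact: fge.
Qed.

End NonVanishing.

(** * The free monoid and its Moebius function *)

Section MultisetArithmetic.
Local Open Scope mset_scope.
Variables (P : countType) (deg : P -> nat).
Hypothesis deg_gt0 : forall p, (0 < deg p)%N.
Hypothesis fin_deg : forall n, finite_set [set g : {mset P} | mdeg deg g = n].
Implicit Types (g h r : {mset P}) (p : P) (n k : nat) (A : pred P).

Lemma perm_enum_msetD g h : perm_eq (g `+` h) (g ++ h).
Proof.
apply/allP => x _ /=; rewrite count_cat -!/(count_mem x _) !count_mem_mset msetE2.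
exact: eqxx.
Qed.

Lemma mdegD g h : mdeg deg (g `+` h) = (mdeg deg g + mdeg deg h)%N.
Proof. by rewrite /mdeg (perm_big _ (perm_enum_msetD g h)) big_cat. Qed.

Lemma size_msetD g h : size (g `+` h) = (size g + size h)%N.
Proof. by rewrite (perm_size (perm_enum_msetD g h)) size_cat. Qed.

Lemma mdeg1 p : mdeg deg [mset p] = deg p.
Proof. by rewrite /mdeg enum_msetn big_seq1. Qed.

Lemma mdeg0 : mdeg deg mset0 = 0%N.
Proof. by rewrite /mdeg enum_mset0 big_nil. Qed.

Lemma mdeg1D p g : mdeg deg (p +` g) = (deg p + mdeg deg g)%N.
Proof. by rewrite mdegD mdeg1. Qed.

Lemma mset1B p g : p \in g -> p +` (g `\ p) = g.
Proof. exact: msetB1K. Qed.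

Lemma mdegB1 p g : p \in g -> (deg p + mdeg deg (g `\ p))%N = mdeg deg g.
Proof. by move=> pg; rewrite -[in RHS](mset1B pg) mdeg1D. Qed.

Lemma deg_le_mdeg p g : p \in g -> (deg p <= mdeg deg g)%N.
Proof. by move=> /mdegB1 <-; exact: leq_addr. Qed.

Lemma mset_neq0P g : reflect (exists p, p \in g) (g != mset0).
Proof.
apply: (iffP idP) => [g0|[p pg]]; last first.
  by apply/eqP => g0; rewrite g0 in_mset0 in pg.
apply: contrapT => h; move/negP: g0; apply; apply/eqP/msetP => p.
by rewrite mset0E; apply/mset_eq0P/negP => pg; apply: h; exists p.
Qed.

Lemma mdeg_eq0 g : (mdeg deg g == 0%N) = (g == mset0).
Proof.
apply/idP/eqP => [|->]; last by rewrite mdeg0.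
apply: contraTeq => /mset_neq0P[p /deg_le_mdeg]; rewrite -lt0n; exact: leq_trans.
Qed.

Lemma mdeg_mono g h : (h `<=` g)%mset -> (mdeg deg h <= mdeg deg g)%N.
Proof. by move=> hg; rewrite -(msetBDKC hg) mdegD leq_addr. Qed.

Lemma mdegB g h : (h `<=` g)%mset -> (mdeg deg h + mdeg deg (g `\` h))%N = mdeg deg g.
Proof. by move=> hg; rewrite -mdegD msetBDKC. Qed.

Definition lev n : seq {mset P} := fset_set [set g : {mset P} | mdeg deg g = n].

Lemma mem_lev n g : (g \in lev n) = (mdeg deg g == n).
Proof.
rewrite (in_fset_set (fin_deg n)).
by apply/idP/eqP => [/set_mem//|gn]; exact/mem_set.
Qed.

Lemma lev_uniq n : uniq (lev n).
Proof. exact: fset_uniq. Qed.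

Definition ball n : seq {mset P} := flatten [seq lev k | k <- iota 0 n.+1].

Lemma mem_ball n g : (g \in ball n) = (mdeg deg g <= n)%N.
Proof.
apply/flatten_mapP/idP => [[k]|gn].
  by rewrite mem_iota mem_lev => /andP[_ kn] /eqP ->.
by exists (mdeg deg g); rewrite ?mem_lev ?eqxx // mem_iota.
Qed.

Lemma ball_uniq n : uniq (ball n).
Proof.
rewrite /ball; elim: n => [|n IH]; first by rewrite /= cats0 lev_uniq.
rewrite -addn1 iotaD map_cat flatten_cat cat_uniq IH /= cats0 lev_uniq andbT.
apply/hasPn => g; rewrite mem_lev => /eqP gE; apply/negP => /=.
by rewrite -/(ball n) mem_ball gE add0n ltnn.
Qed.

Lemma big_ball (K : nmodType) n (F : {mset P} -> K) :
  \sum_(g <- ball n) F g = \sum_(k < n.+1) \sum_(g <- lev k) F g.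
Proof. by rewrite /ball big_flatten big_map -(big_mkord predT (fun k => \sum_(g <- lev k) F g)). Qed.

Lemma lev0 : perm_eq (lev 0) [:: mset0].
Proof.
by apply: uniq_perm => [||g]; rewrite ?lev_uniq // mem_lev mdeg_eq0 inE.
Qed.

Definition sub_mset g : seq {mset P} := [seq h <- ball (mdeg deg g) | (h `<=` g)%mset].

Lemma mem_sub_mset g h : (h \in sub_mset g) = (h `<=` g)%mset.
Proof. by rewrite mem_filter mem_ball; apply: andb_idr => /mdeg_mono. Qed.

Lemma sub_mset_uniq g : uniq (sub_mset g).
Proof. exact: filter_uniq (ball_uniq _). Qed.

Lemma fsbig_seqE (T : choiceType) (K : nmodType) (X : set T) (s : seq T) (F : T -> K) :
  uniq s -> (forall x, X x -> x \in s) ->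
  \sum_(x \in X) F x = \sum_(x <- s | `[< X x >]) F x.
Proof.
move=> us Xs.
have fX : finite_set X.
  by apply: (@sub_finite_set _ _ [set` s]) => //; exact: finite_seq.
rewrite fsbig_finite //= -[RHS]big_filter; apply: perm_big.
apply: uniq_perm; rewrite ?fset_uniq ?filter_uniq // => x.
rewrite in_fset_set // mem_filter; apply/idP/andP => [/set_mem Xx|[/asboolP Xx _]].
  by split; [exact/asboolP|exact: Xs].
exact/mem_set.
Qed.

Lemma fsbig_lev (K : nmodType) n (F : {mset P} -> K) :
  \sum_(g \in [set g : {mset P} | mdeg deg g = n]) F g = \sum_(g <- lev n) F g.
Proof. by rewrite fsbig_finite. Qed.

(** The coefficients of the generating series of [u] by degree; convolution on the monoid becomes
    [conv] of these sequences ([gen_conv]). *)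
Definition gen (K : nmodType) (u : {mset P} -> K) n : K := \sum_(g <- lev n) u g.

Lemma eq_gen (K : nmodType) (u v : {mset P} -> K) : u =1 v -> gen u =1 gen v.
Proof. by move=> uv n; apply: eq_bigr => g _; exact: uv. Qed.

(** The map (h, r) -> h + r is a bijection onto pairs of an element and one of its divisors, graded
    by the degree k of h. *)
Lemma sum_pairs (K : nmodType) (W : {mset P} -> {mset P} -> K) n :
  \sum_(g <- lev n) \sum_(h <- sub_mset g) W h (g `\` h)%mset =
  \sum_(k < n.+1) \sum_(h <- lev k) \sum_(r <- lev (n - k)) W h r.
Proof.
transitivity (\sum_(g <- lev n) \sum_(h <- ball n | (h `<=` g)%mset) W h (g `\` h)%mset).
  rewrite big_seq [RHS]big_seq; apply: eq_bigr => g; rewrite mem_lev => /eqP gn.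
  by rewrite big_filter gn.
under eq_bigr do rewrite big_mkcond /=.
rewrite exchange_big /= big_ball; apply: eq_bigr => k _.
rewrite big_seq [RHS]big_seq; apply: eq_bigr => h; rewrite mem_lev => /eqP hk.
rewrite -big_mkcond /= -big_filter.
rewrite (perm_big [seq h `+` r | r <- lev (n - k)]) ?big_map /=.
  by apply: eq_bigr => r _; rewrite msetDKB.
apply: uniq_perm; rewrite ?filter_uniq ?lev_uniq ?map_inj_uniq ?lev_uniq //.
  by move=> x y /(congr1 (fun z => (z `\` h)%mset)); rewrite !msetDKB.
move=> g; rewrite mem_filter mem_lev; apply/andP/mapP => [[hg /eqP gn]|[r]].
  exists (g `\` h)%mset; last by rewrite msetBDKC.
  by rewrite mem_lev; apply/eqP; have := mdegB hg; rewrite hk gn; lia.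
rewrite mem_lev => /eqP rE ->; split.
  by apply/msubsetP => x; rewrite msetE2 leq_addr.
by rewrite mdegD hk rE subnKC // -ltnS.
Qed.

Lemma gen_conv (K : comNzRingType) (u v : {mset P} -> K) n :
  gen (fun g => \sum_(h <- sub_mset g) u h * v (g `\` h)%mset) n = conv (gen u) (gen v) n.
Proof.
rewrite /gen (sum_pairs (fun h r => u h * v r)); apply: eq_bigr => k _.
by rewrite big_distrlr.
Qed.

Lemma gen_shift (K : nmodType) (u : {mset P} -> K) p n :
  gen (fun g => if p \in g then u (g `\ p) else 0) n =
  if (deg p <= n)%N then gen u (n - deg p) else 0.
Proof.
rewrite /gen -big_mkcond /= -big_filter; case: ifPn => [pn|].
  rewrite (perm_big [seq p +` h | h <- lev (n - deg p)]) ?big_map /=.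
    by apply: eq_bigr => h _; rewrite msetD1K.
  apply: uniq_perm; rewrite ?filter_uniq ?lev_uniq ?map_inj_uniq ?lev_uniq //.
    by move=> x y /(congr1 (fun z => z `\ p)); rewrite !msetD1K.
  move=> g; rewrite mem_filter mem_lev; apply/andP/mapP => [[pg /eqP gn]|[h]].
    exists (g `\ p); last by rewrite mset1B.
    by rewrite mem_lev -gn -(mdegB1 pg) addKn.
  by rewrite mem_lev => /eqP hE ->; rewrite mset1D1 mdeg1D hE subnKC.
rewrite -ltnNge => np; rewrite big_filter big_seq_cond big1 // => g.
rewrite mem_lev => /andP[/eqP gn /deg_le_mdeg]; rewrite gn leqNgt; exact: contraNP.
Qed.

Lemma sub_mset_with p g : p \in g ->
  perm_eq [seq h <- sub_mset g | p \in h] [seq p +` h | h <- sub_mset (g `\ p)].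
Proof.
move=> pg; apply: uniq_perm; rewrite ?filter_uniq ?sub_mset_uniq ?ball_uniq ?map_inj_uniq ?sub_mset_uniq //.
  by move=> x y /(congr1 (fun z => z `\ p)); rewrite !msetD1K.
have gp : (0 < g p)%N by rewrite mset_gt0.
move=> h; rewrite mem_filter mem_sub_mset; apply/andP/mapP => [[ph hg]|[h']].
  exists (h `\ p); last by rewrite mset1B.
  rewrite mem_sub_mset; apply/msubsetP => x; rewrite !msetB1E.
  by apply: leq_sub2r; exact: (msubsetP hg).
rewrite mem_sub_mset => /msubsetP hg ->; rewrite mset1D1; split=> //.
apply/msubsetP => x; rewrite mset1DE; have := hg x; rewrite msetB1E.
by case: eqP => [->|_] /=; [move: (h' p) (g p) gp|move: (h' x) (g x)] => a b; lia.
Qed.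

Definition mset_over A g := all A (finsupp g).

Lemma mset_overP A g : reflect (forall p, p \in g -> A p) (mset_over A g).
Proof.
apply: (iffP allP) => h p; first by rewrite -msuppE; exact: h.
by rewrite msuppE; exact: h.
Qed.

Definition squarefree g := all (fun p => (g p <= 1)%N) (finsupp g).

Lemma squarefreeP g : reflect (forall p, (g p <= 1)%N) (squarefree g).
Proof.
apply: (iffP allP) => [h p|h p _]; last exact: h.
have [pg|pg] := boolP (p \in finsupp g); first exact: h.
by rewrite memNfinsupp in pg; rewrite (eqP pg).
Qed.

Section Mobius.
Variable K : comNzRingType.
Local Notation mu := (@mobius P K).

Lemma mobiusE g : mu g = if squarefree g then (-1) ^+ size g else 0.
Proof. by []. Qed.

Lemma mobius0 : mu mset0 = 1.
Proof.
rewrite mobiusE ifT ?enum_mset0 ?expr0 //.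
by apply/squarefreeP => p; rewrite mset0E.
Qed.

Lemma mobius_gt1 p g : (1 < g p)%N -> mu g = 0.
Proof. by move=> gp; rewrite mobiusE ifN //; apply/squarefreeP => /(_ p); lia. Qed.

Lemma mobius1D p g : p \notin g -> mu (p +` g) = - mu g.
Proof.
move=> pg; rewrite !mobiusE size_msetD enum_msetn /= exprD expr1 mulN1r.
have -> : squarefree (p +` g) = squarefree g.
  apply/squarefreeP/squarefreeP => h x; have := h x; rewrite mset1DE; first by lia.
  by case: eqP => [->|] //=; rewrite (mset_eq0P pg).
by case: ifP => _; rewrite ?oppr0.
Qed.

(** The Moebius function of the submonoid generated by A, extended by 0; formally its generating
    series is the product of 1 - z^(deg p) over p in A. *)
Definition muA A g : K := if mset_over A g then mu g else 0.

Lemma muA_gt1 A p g : (1 < g p)%N -> muA A g = 0.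
Proof. by move=> gp; rewrite /muA (mobius_gt1 gp) if_same. Qed.

Lemma muA_notin A p g : p \in g -> ~~ A p -> muA A g = 0.
Proof. by move=> pg Ap; rewrite /muA ifN //; apply/mset_overP => /(_ p pg); exact/negP. Qed.

Lemma muA1D A p g : A p -> p \notin g -> muA A (p +` g) = - muA A g.
Proof.
move=> Ap pg; rewrite /muA (mobius1D pg).
have -> : mset_over A (p +` g) = mset_over A g.
  apply/mset_overP/mset_overP => h x; first by move=> xg; apply: h; exact: mset1Dr.
  by rewrite in_mset1D => /orP[/eqP -> //|]; exact: h.
by case: ifP => _; rewrite ?oppr0.
Qed.

(** If some p in A divides g, divisors containing p twice contribute 0, and the others cancel in
    pairs h, p + h with h free of p. If no such p exists, only the identity contributes. *)
Lemma sum_muA A g : \sum_(h <- sub_mset g) muA A h = (mset_over (predC A) g)%:R.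
Proof.
have [/mset_overP ov|] := boolP (mset_over (predC A) g).
  rewrite (bigD1_seq mset0) ?sub_mset_uniq ?mem_sub_mset ?msub0set //=.
  rewrite {1}/muA ifT; last by apply/mset_overP => p; rewrite in_mset0.
  rewrite mobius0 big_seq_cond big1 ?addr0 // => h /andP[].
  rewrite mem_sub_mset => hg /mset_neq0P[p ph].
  by apply: (muA_notin ph); apply: ov; exact: (msubset_subset hg).
move=> /allPn[p]; rewrite msuppE /= negbK => pg Ap.
rewrite (bigID (fun h => p \in h)) /= -big_filter (perm_big _ (sub_mset_with pg)) big_map /=.
rewrite (bigID (fun h => p \in h)) /= [X in X + _ + _]big1 ?add0r => [|h ph]; last first.
  by apply: (@muA_gt1 _ p); rewrite mset1DE eqxx; move: ph; rewrite in_mset; lia.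
rewrite -[X in _ + X]big_filter -[X in X + _]big_filter.
rewrite [X in X + _](perm_big [seq h <- sub_mset g | p \notin h]) /=; last first.
  apply: uniq_perm; rewrite ?filter_uniq ?sub_mset_uniq ?ball_uniq // => h.
  rewrite mem_filter mem_sub_mset [RHS]mem_filter mem_sub_mset; apply: andb_id2l => ph.
  apply/msubsetP/msubsetP => hg x; have := hg x; rewrite msetB1E; first by lia.
  by case: eqP => [->|] /=; rewrite ?(mset_eq0P ph) //; lia.
rewrite !big_filter -big_split /= big1 // => h ph.
by rewrite muA1D // addNr.
Qed.

Lemma gen_muA A n :
  conv (gen (muA A)) (gen (fun=> 1)) n = gen (fun g => (mset_over (predC A) g)%:R) n.
Proof.
rewrite -gen_conv; apply: eq_gen => g; rewrite -sum_muA.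
by apply: eq_bigr => h _; rewrite mulr1.
Qed.

(** The recursion that matches multiplication by [1 - 'X^(deg p)]: a squarefree element over p :: s
    avoids p or is p plus an element over s. *)
Lemma muA_cons p (s : seq P) g : p \notin s ->
  muA (mem (p :: s)) g = muA (mem s) g - (if p \in g then muA (mem s) (g `\ p) else 0).
Proof.
move=> ps; case: ifPn => pg; last first.
  rewrite subr0 /muA; congr (if _ then _ else _).
  apply/mset_overP/mset_overP => h x xg; have := h x xg; rewrite /= inE.
    by case/orP => // /eqP xp; rewrite xp (negPf pg) in xg.
  by move=> ->; rewrite orbT.
rewrite (muA_notin (A := mem s) pg) // sub0r.
have [gp|gp] := boolP (1 < g p)%N.
  rewrite (muA_gt1 _ gp) (@muA_notin _ p) ?oppr0 //.
  by rewrite in_mset msetB1E eqxx; lia.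
have pgp : p \notin g `\ p by rewrite -mset_eq0 msetB1E eqxx; lia.
have hp : mem (p :: s) p by exact: mem_head.
rewrite -[in LHS](mset1B pg) (muA1D hp pgp); congr (- _).
rewrite /muA; congr (if _ then _ else _).
apply/mset_overP/mset_overP => h x xg; have := h x xg; rewrite /= inE.
  by case/orP => // /eqP xp; rewrite xp (negPf pgp) in xg.
by move=> ->; rewrite orbT.
Qed.

Lemma coef_euler (s : seq P) n : uniq s ->
  (\prod_(p <- s) (1 - 'X^(deg p)) : {poly K})`_n = gen (muA (mem s)) n.
Proof.
elim: s n => [|p s IH] n /=.
  rewrite big_nil coef1 /gen => _; case: n => [|n].
    rewrite (perm_big _ lev0) big_seq1 /muA ifT ?mobius0 //.
    by apply/mset_overP => p; rewrite in_mset0.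
  rewrite /= big_seq big1 // => g; rewrite mem_lev => /eqP gn.
  have /mset_neq0P[p pg] : g != mset0 by rewrite -mdeg_eq0 gn.
  exact: (@muA_notin _ p).
case/andP => ps us; rewrite big_cons mulrBl mul1r coefB coefXnM IH //.
rewrite /gen (eq_bigr _ (fun g _ => muA_cons g ps)) sumrB; congr (_ - _).
have := gen_shift (muA (mem s)) p n; rewrite /gen => ->.
by rewrite ltnNge; case: leqP => // _; rewrite IH.
Qed.

Lemma muA_ball A B n : (forall p, (deg p <= n)%N -> A p = B p) -> gen (muA A) n = gen (muA B) n.
Proof.
move=> AB; rewrite /gen big_seq [RHS]big_seq; apply: eq_bigr => g; rewrite mem_lev => /eqP gn.
rewrite /muA; congr (if _ then _ else _).
by apply/mset_overP/mset_overP => h p pg; have := h p pg; rewrite AB // -gn deg_le_mdeg.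
Qed.

End Mobius.

End MultisetArithmetic.

(** * Minimal primes and Moebius duality *)

Section MinimalPrime.
Local Open Scope mset_scope.
Variables (P : countType) (deg : P -> nat).
Hypothesis deg_gt0 : forall p, (0 < deg p)%N.
Hypothesis fin_deg : forall n, finite_set [set g : {mset P} | mdeg deg g = n].
Implicit Types (g h r : {mset P}) (p : P) (n k : nat) (A : pred P) (S : set P).

Lemma bigmin_seq_le (s : seq P) (M : nat) p : p \in s ->
  (\big[minn/M]_(x <- s) deg x <= deg p)%N.
Proof.
elim: s => // x s IH; rewrite inE big_cons => /orP[/eqP ->|/IH h]; first exact: geq_minl.
by rewrite geq_min h orbT.
Qed.

Lemma bigmin_seq_attained (s : seq P) (M : nat) :
  \big[minn/M]_(x <- s) deg x = M \/ exists2 p, p \in s & \big[minn/M]_(x <- s) deg x = deg p.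
Proof.
elim: s => [|x s IH]; first by left; rewrite big_nil.
rewrite big_cons minnE; case: (leqP (deg x) (\big[minn/M]_(y <- s) deg y)) => h.
  right; exists x; first exact: mem_head.
  by rewrite (eqP h) subn0.
rewrite subKn ?(ltnW h) //; case: IH => [|[p ps ->]]; first by left.
by right; exists p => //; rewrite inE ps orbT.
Qed.

Lemma dplus_max g p : p \in g -> (deg p <= dplus deg g)%N.
Proof. by rewrite -msuppE => pg; rewrite /dplus (big_fsetD1 p pg) leq_maxl. Qed.

Lemma dplus_attained g : g != mset0 -> exists2 p, p \in g & deg p = dplus deg g.
Proof.
move=> /mset_neq0P[p0 p0g].
have H (s : seq P) : s != [::] -> exists2 p, p \in s & deg p = \max_(x <- s) deg x.
  elim: s => // x [|y s] IH _; first by exists x; rewrite ?mem_head // big_seq1.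
  have [p ps pE] := IH isT; rewrite big_cons.
  case: (leqP (\max_(z <- y :: s) deg z) (deg x)) => h.
    by exists x; rewrite ?mem_head // (maxn_idPl h).
  by exists p => //; rewrite in_cons ps orbT.
have [|p ps pE] := H (finsupp g); last by exists p; rewrite -?msuppE.
by apply/eqP => h; move: p0g; rewrite -msuppE -[_ \in _]/(p0 \in (finsupp g : seq P)) h.
Qed.

Lemma dminus_min g p : p \in g -> (dminus deg g <= deg p)%N.
Proof.
move=> pg; rewrite /dminus ifN; last by apply/mset_neq0P; exists p.
by apply: bigmin_seq_le; rewrite msuppE.
Qed.

(** The default value [dplus] of the minimum is itself the degree of a prime of g, so it creates no
    spurious minimum. *)
Lemma dminus_attained g : g != mset0 -> exists2 p, p \in g & deg p = dminus deg g.
Proof.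
move=> g0; have [q qg qE] := dplus_attained g0.
rewrite /dminus ifN //; have [h|[p pg ->]] := bigmin_seq_attained (finsupp g) (dplus deg g).
  by exists q; rewrite // h.
by exists p; rewrite // -msuppE.
Qed.

(** Strict inequality against the other primes expresses minimality and uniqueness at once, while
    the multiplicity of p stays free, as in [distinguishable]. *)
Definition isPmin S g p : Prop :=
  [/\ p \in g, S p & forall x, x \in g -> x != p -> (deg p < deg x)%N].

Definition hasPmin S g : bool := `[< exists p, isPmin S g p >].

Lemma dminus_isPmin S g p : isPmin S g p -> dminus deg g = deg p.
Proof.
move=> [pg _ pmin]; apply/eqP; rewrite eqn_leq dminus_min //=.
have [|q qg <-] := @dminus_attained g; first by apply/mset_neq0P; exists p.
by have [->//|qp] := eqVneq q p; rewrite ltnW // pmin.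
Qed.

Lemma hasPmin_neq0 S g : hasPmin S g -> g != mset0.
Proof. by move=> /asboolP[p [pg _ _]]; apply/mset_neq0P; exists p. Qed.

Lemma inD_hasPmin S g : g != mset0 -> (inD deg S g <-> hasPmin S g).
Proof.
move=> g0; split=> [[gE|[]]|].
- by rewrite gE eqxx in g0.
- rewrite /distinguishable /Pmin => /andP[_]; rewrite -size_filter.
  case E: [seq p <- finsupp g | deg p == dminus deg g] => [|p [|]] //= _ [_ [<-] Sp].
  have [pg pE] : p \in g /\ deg p = dminus deg g.
    have : p \in [seq p <- finsupp g | deg p == dminus deg g] by rewrite E mem_head.
    by rewrite mem_filter msuppE => /andP[/eqP].
  apply/asboolP; exists p; split=> // x xg xp; rewrite ltn_neqAle pE dminus_min // andbT.
  apply: contra xp => /eqP xE.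
  have : x \in [seq p <- finsupp g | deg p == dminus deg g].
    by rewrite mem_filter msuppE xg xE eqxx.
  by rewrite E inE.
- move=> /asboolP[p pP]; have [pg Sp pmin] := pP; right.
  have E : [seq x <- finsupp g | deg x == dminus deg g] = [:: p].
    apply/perm_small_eq => //; apply: uniq_perm; rewrite ?filter_uniq ?fset_uniq // => x.
    rewrite mem_filter msuppE inE (dminus_isPmin pP).
    apply/andP/eqP => [[/eqP xp xg]|-> //].
    by apply/eqP; apply: contraPT xp => xp; have := pmin x xg xp; lia.
  split; last by exists p; rewrite // /Pmin E.
  by rewrite /distinguishable g0 -size_filter E.
Qed.

Section Decomposition.
Variable K : comNzRingType.
Implicit Types (F : nat -> K).
Local Notation mu := (@mobius P K).

Definition above k : pred P := fun x => (k < deg x)%N.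

(* Only the minimal prime of [g] contributes to the sum on the right. *)
Lemma mobius_peel S F g :
  (if hasPmin S g then mu g * F (dminus deg g) else 0) =
  - \sum_(p <- finsupp g | `[< S p >]) F (deg p) * muA K (above (deg p)) (g `\ p).
Proof.
case: ifPn => [/asboolP[p pP]|/asboolPn nP].
  have [pg Sp pmin] := pP; rewrite (dminus_isPmin pP).
  have pf : p \in finsupp g by rewrite msuppE.
  rewrite big_mkcond (big_fsetD1 p pf) /= asboolT // [X in _ + X]big_seq [X in _ + X]big1 ?addr0.
    (* A repeated p kills both sides: mu g = 0, and p survives in g - p without being above its own
       degree. *)
    have [gp|gp] := boolP (1 < g p)%N.
      rewrite (mobius_gt1 _ gp) mul0r (@muA_notin _ _ _ p) ?mulr0 ?oppr0 //.
        by rewrite in_mset msetB1E eqxx; lia.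
      by rewrite /above ltnn.
    have pgp : p \notin g `\ p by rewrite -mset_eq0 msetB1E eqxx; lia.
    rewrite -{1}(mset1B pg) mobius1D // mulNr mulrC; congr (- (_ * _)).
    rewrite /muA ifT //; apply/mset_overP => x xg; apply: pmin.
      by move: xg; rewrite in_msetB1 => /andP[].
    by apply/eqP => xp; rewrite xp (negPf pgp) in xg.
  move=> x; rewrite !inE msuppE => /andP[xp xg]; case: ifP => // _.
  rewrite (@muA_notin _ _ _ p) ?mulr0 //.
    by rewrite in_mset msetB1E eq_sym (negPf xp) subn0 -in_mset.
  by rewrite /above -leqNgt ltnW // pmin.
rewrite big_seq_cond big1 ?oppr0 // => p /andP[]; rewrite msuppE => pg /asboolP Sp.
rewrite /muA ifN ?mulr0 //; apply: contra_notN nP => /mset_overP ov.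
exists p; split=> // x xg xp; apply: ov.
by rewrite in_mset msetB1E (negPf xp) subn0 -in_mset.
Qed.

Lemma sum_finsupp_sub (F' : P -> K) g h : h `<=` g ->
  \sum_(p <- finsupp h) F' p = \sum_(p <- finsupp g) (if p \in h then F' p else 0).
Proof.
move=> hg; rewrite -big_mkcond /= -[RHS]big_filter; apply: perm_big.
apply: uniq_perm; rewrite ?filter_uniq ?fset_uniq // => x.
rewrite mem_filter !msuppE; apply/idP/andP => [xh|[]//]; split=> //.
exact: (msubset_subset hg).
Qed.

(** Peel the minimal prime p off each divisor. The rest runs over all divisors of g - p, and by
    [sum_muA] its Moebius sum detects that no prime of g - p has degree above deg p, that is, deg p
    = d^+(g). *)
Lemma duality S F g :
  \sum_(h <- sub_mset deg g) (if hasPmin S h then mu h * F (dminus deg h) else 0) =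
  - ((QS deg S g)%:R * F (dplus deg g)).
Proof.
under eq_bigr do rewrite mobius_peel big_mkcond.
rewrite sumrN; congr (- _).
rewrite big_seq; under eq_bigr => h.
  rewrite mem_sub_mset // => hg; rewrite (sum_finsupp_sub _ hg); over.
rewrite -big_seq exchange_big /= /QS -sum1_count natr_sum mulr_suml.
rewrite [RHS]big_mkcond /= big_seq [RHS]big_seq; apply: eq_bigr => p.
rewrite msuppE => pg.
rewrite -big_mkcond /= -big_filter (perm_big _ (sub_mset_with fin_deg pg)) big_map /=.
case: asboolP => Sp /=; last by rewrite big1.
under eq_bigr do rewrite msetD1K.
rewrite -mulr_sumr sum_muA //.
have -> : mset_over (predC (above (deg p))) (g `\ p) = (deg p == dplus deg g).
  apply/mset_overP/eqP => [ov|pE x xg]; last first.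
    rewrite /= /above -leqNgt pE; apply: dplus_max.
    by move: xg; rewrite in_msetB1 => /andP[].
  apply/eqP; rewrite eqn_leq dplus_max //=.
  have [|q qg <-] := @dplus_attained g; first by apply/mset_neq0P; exists p.
  have [->//|qp] := eqVneq q p; rewrite leqNgt; apply: ov.
  by rewrite in_mset msetB1E (negPf qp) subn0 -in_mset.
by case: eqP => [->|_]; rewrite ?mulr1 ?mul1r ?mulr0.
Qed.

(** If every prime of r is p or of larger degree, p stays minimal in r + h. Otherwise r contains a
    competitor of degree at most deg p, and a minimal prime of r + h must lie in r and have degree
    below deg p; a mere tie with p makes both sides vanish. *)
Lemma hasPmin_shift S F h r p : isPmin S h p ->
  (if hasPmin S (r `+` h) then F (dminus deg (r `+` h)) else 0) =
  (if mset_over (fun x => (deg p < deg x)%N || (x == p)) r then F (deg p) else 0) +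
  (if hasPmin S r then (if (dminus deg r < deg p)%N then F (dminus deg r) else 0) else 0).
Proof.
move=> pP; have [ph Sp pmin] := pP.
have hge x : x \in h -> (deg p <= deg x)%N.
  by move=> xh; have [->//|xp] := eqVneq x p; rewrite ltnW // pmin.
have [/mset_overP ov|nov] := boolP (mset_over _ r).
  have rhP : isPmin S (r `+` h) p.
    split=> //; first by rewrite in_msetD ph orbT.
    move=> x; rewrite in_msetD => /orP[/ov /orP[//|/eqP ->]|xh xp]; first by rewrite eqxx.
    exact: pmin.
  rewrite ifT ?(dminus_isPmin rhP); last by apply/asboolP; exists p.
  rewrite [X in _ + X](_ : _ = 0) ?addr0 //; case: ifP => // rP.
  rewrite ifN // -leqNgt; have [q qr <-] := dminus_attained (hasPmin_neq0 rP).
  by have := ov q qr; case/orP => [/ltnW//|/eqP ->].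
rewrite add0r; move: nov => /allPn[x]; rewrite msuppE negb_or -leqNgt => xr /andP[xp1 xp2].
have fwd q : isPmin S (r `+` h) q -> isPmin S r q /\ (deg q < deg p)%N.
  move=> [qrh Sq qmin]; have qp : (deg q < deg p)%N.
    have [qx|qx] := eqVneq x q; last first.
      by apply: leq_trans xp1; apply: qmin; rewrite // in_msetD xr.
    by apply: qmin; rewrite ?in_msetD ?ph ?orbT // -qx eq_sym.
  split=> //; split=> // [|y yr yq]; last by apply: qmin; rewrite // in_msetD yr.
  by move: qrh; rewrite in_msetD => /orP[//|/hge]; lia.
have bwd q : isPmin S r q -> (deg q < deg p)%N -> isPmin S (r `+` h) q.
  move=> [qr Sq qmin] qp; split=> // [|y]; first by rewrite in_msetD qr.
  rewrite in_msetD => /orP[yr|yh] yq; first exact: qmin.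
  by have := hge y yh; lia.
case: ifPn => [/asboolP[q qP]|nP].
  have [qP' qp] := fwd q qP.
  rewrite ifT; last by apply/asboolP; exists q.
  by rewrite (dminus_isPmin qP) (dminus_isPmin qP') qp.
case: ifPn => // /asboolP[q qP]; rewrite (dminus_isPmin qP); case: ifPn => // qp.
by case/negP: nP; apply/asboolP; exists q; exact: bwd.
Qed.

End Decomposition.

Section PrimeLists.

Lemma finite_primes n : finite_set [set p : P | (deg p <= n)%N].
Proof.
have /sub_finite_set : ([set p : P | (deg p <= n)%N] `<=`
    [set` flatten (map (fun x : {mset P} => (x : seq P)) (ball deg n))])%classic; last first.
  by apply; exact: finite_seq.
move=> p /= pn; apply/flattenP; exists ([mset p] : seq P).
  by apply/mapP; exists [mset p]; rewrite ?mem_ball ?mdeg1.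
by rewrite enum_msetn inE.
Qed.

Definition primes_le n : seq P := fset_set [set p : P | (deg p <= n)%N].

Lemma mem_primes_le n p : (p \in primes_le n) = (deg p <= n)%N.
Proof.
rewrite (in_fset_set (finite_primes n)).
by apply/idP/idP => [/set_mem//|gn]; exact/mem_set.
Qed.

Lemma primes_le_uniq n : uniq (primes_le n).
Proof. exact: fset_uniq. Qed.

Lemma pcountE n k : (k <= n)%N -> pcount deg k = (\sum_(p <- primes_le n | deg p == k) 1)%N.
Proof.
move=> kn; rewrite /pcount (@fsbig_seqE _ _ _ (primes_le n)) ?primes_le_uniq //.
  by apply: eq_bigl => p; apply/asboolP/eqP.
by move=> p /= pk; rewrite mem_primes_le pk.
Qed.

Lemma sum_primes_le (K : pzSemiRingType) n (F : nat -> K) :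
  \sum_(p <- primes_le n) F (deg p) = \sum_(k < n.+1) (pcount deg k)%:R * F k.
Proof.
rewrite big_seq (partition_big (fun p => inord (deg p) : 'I_n.+1) predT) //=.
apply: eq_bigr => k _; rewrite (@pcountE n) ?natr_sum ?mulr_suml; last by rewrite -ltnS.
rewrite [RHS]big_seq_cond; apply: eq_big => p.
  rewrite mem_primes_le; apply: andb_id2l => pn.
  by rewrite -val_eqE /= inordK.
by rewrite mem_primes_le mul1r => /andP[pn /eqP <-]; rewrite inordK.
Qed.

Lemma prod_primes_le (K : comNzRingType) n (F : nat -> K) :
  \prod_(p <- primes_le n) F (deg p) = \prod_(1 <= k < n.+1) F k ^+ pcount deg k.
Proof.
transitivity (\prod_(k < n.+1) F k ^+ pcount deg k).
  rewrite big_seq (partition_big (fun p => inord (deg p) : 'I_n.+1) predT) //=.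
  apply: eq_bigr => k _; rewrite (@pcountE n); last by rewrite -ltnS.
  rewrite -prodrXr expr1 [RHS]big_seq_cond; apply: eq_big => p.
    rewrite mem_primes_le; apply: andb_id2l => pn.
    by rewrite -val_eqE /= inordK.
  by rewrite mem_primes_le => /andP[pn /eqP <-]; rewrite inordK.
rewrite -(big_mkord predT (fun k => F k ^+ pcount deg k)) [LHS]big_ltn //.
rewrite (@pcountE n) // big_seq_cond big1 ?expr0 ?mul1r // => p /andP[_ /eqP p0].
by have := deg_gt0 p; rewrite p0.
Qed.

(** Exchange the sums over g and over p dividing g, then remove p by [gen_shift]; [s] may miss only
    primes that contribute nothing. *)
Lemma gen_sum_finsupp (K : nmodType) (u : P -> {mset P} -> K) n (s : seq P) :
    uniq s -> (forall p g, (deg p <= n)%N -> p \notin s -> u p g = 0) ->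
  gen deg (fun g => \sum_(p <- finsupp g) u p (g `\ p)) n =
  \sum_(p <- s) (if (deg p <= n)%N then gen deg (u p) (n - deg p) else 0).
Proof.
move=> us us0; under [RHS]eq_bigr do rewrite -gen_shift //.
rewrite /gen exchange_big /= big_seq [RHS]big_seq; apply: eq_bigr => g.
rewrite mem_lev // => /eqP gn.
rewrite (bigID (fun p => p \in s)) /= [X in _ + X]big_seq_cond [X in _ + X]big1 ?addr0; last first.
  move=> p /andP[]; rewrite msuppE => pg ps; apply: us0 => //.
  by rewrite -gn deg_le_mdeg.
rewrite -[RHS]big_mkcond /= -[LHS]big_filter -[RHS]big_filter.
apply: perm_big.
apply: uniq_perm; rewrite ?filter_uniq ?fset_uniq // => p.
by rewrite !mem_filter msuppE andbC.
Qed.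

End PrimeLists.

End MinimalPrime.

(** * Semigroups satisfying Axiom A# *)

Section ArithmeticalSemigroup.
Variables (R : realType) (P : countType) (deg : P -> nat).
Hypothesis deg_gt0 : forall p, (0 < deg p)%N.
Hypothesis fin_deg : forall n, finite_set [set g : {mset P} | mdeg deg g = n].
Variables (c q eta : R).
Hypotheses (c_gt0 : 0 < c) (q_gt1 : 1 < q) (eta_lt1 : eta < 1).
Hypothesis axiomA : exists (K : R) (N : nat), forall n : nat, (N <= n)%N ->
  `| Gcount deg R n - c * q ^+ n | <= K * q `^ (eta * n%:R).
Implicit Types (A : pred P) (n k N : nat) (z w : R[i]).

Let q_gt0 : 0 < q. Proof. exact: lt_trans q_gt1. Qed.
Let qX_gt0 n : 0 < q ^+ n. Proof. exact: exprn_gt0. Qed.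
Let qVX_ge0 n : 0 <= q^-1 ^+ n. Proof. by rewrite exprn_ge0 // invr_ge0 ltW. Qed.
Let nc1 : nc (1 : R[i]) = 1. Proof. exact: Normc.normc1. Qed.
Let nc0 : nc (0 : R[i]) = 0. Proof. exact: Normc.normc0. Qed.
Let qX_neq0 n : q ^+ n != 0. Proof. by rewrite gt_eqF. Qed.

(** Division by q^n moves the critical radius 1/q of Z to 1. *)
Definition scaled_gen (u : {mset P} -> R) n : R := gen deg u n * (q^-1) ^+ n.

Local Notation gam := (scaled_gen (fun=> 1)).
Local Notation mm A := (scaled_gen (muA R A)).

Lemma GcountE n : Gcount deg R n = gen deg (fun=> 1) n.
Proof. by rewrite /Gcount fsbig_lev. Qed.

Lemma gen1_lev0 (K : pzSemiRingType) (u : {mset P} -> K) : gen deg u 0 = u mset0.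
Proof. by rewrite /gen (perm_big _ (lev0 deg_gt0 fin_deg)) big_seq1. Qed.

Lemma gam0 : gam 0 = 1.
Proof. by rewrite /scaled_gen gen1_lev0 expr0 mulr1. Qed.

Lemma scaled_gen_le (u v : {mset P} -> R) n : (forall g, u g <= v g) ->
  scaled_gen u n <= scaled_gen v n.
Proof.
by move=> uv; rewrite ler_wpM2r //; apply: ler_sum => g _; exact: uv.
Qed.

Lemma scaled_gen_ge0 (u : {mset P} -> R) n : (forall g, 0 <= u g) -> 0 <= scaled_gen u n.
Proof.
by move=> u0; rewrite mulr_ge0 //; apply: sumr_ge0 => g _; exact: u0.
Qed.

Lemma gam_ge0 n : 0 <= gam n.
Proof. exact: scaled_gen_ge0. Qed.

Lemma gam_error : exists K rho : R,
  [/\ 0 < K, 0 < rho, rho < 1 & forall n, `|gam n - c| <= K * rho ^+ n].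
Proof.
have [K0 [N HN]] := axiomA.
pose rho := q `^ (eta - 1).
have rho0 : 0 < rho by rewrite powR_gt0.
have rho1 : rho < 1.
  by rewrite /rho /powR gt_eqF // expR_lt1 nmulr_rlt0 ?subr_lt0 // ln_gt0.
have rhoX n : rho ^+ n = q `^ (eta * n%:R) / q ^+ n.
  rewrite /rho -!powR_mulrn ?powR_ge0 ?(ltW q_gt0) // -powRrM.
  by rewrite mulrBl mul1r powRB // (gt_eqF q_gt0) implybT.
pose e n := gam n - c.
(* The sum absorbs the finitely many levels below N, where the axiom is silent; the term 1 makes the
   constant positive. *)
exists (1 + `|K0| + \sum_(i < N) `|e i| / rho ^+ i), rho; split=> //.
  rewrite ltr_wpDr ?ltr_wpDr // sumr_ge0 // => i _.
  by rewrite divr_ge0 // exprn_ge0 // ltW.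
move=> n; have rn : 0 < rho ^+ n by rewrite exprn_gt0.
rewrite -ler_pdivrMr // -/(e n); have [nN|Nn] := ltnP n N.
  rewrite (bigD1 (Ordinal nN)) //= addrCA lerDl.
  by rewrite !addr_ge0 // sumr_ge0 // => i _; rewrite divr_ge0 // exprn_ge0 // ltW.
apply: (@le_trans _ _ `|K0|); last first.
  rewrite -addrA addrCA lerDl addr_ge0 // sumr_ge0 // => i _.
  by rewrite divr_ge0 // exprn_ge0 // ltW.
have E : e n = (Gcount deg R n - c * q ^+ n) / q ^+ n.
  by rewrite /e /scaled_gen GcountE mulrBl mulfK // exprVn.
rewrite E normrM normfV (gtr0_norm (qX_gt0 n)) ler_pdivrMr // rhoX.
rewrite mulrA ler_wpM2r ?invr_ge0 ?(ltW (qX_gt0 n)) // (le_trans (HN n Nn)) //.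
by rewrite ler_wpM2r ?powR_ge0 // ler_norm.
Qed.

Lemma gam_bound : exists2 Gam : R, 0 < Gam & forall n, gam n <= Gam.
Proof.
have [K [rho [K0 r0 r1 H]]] := gam_error; exists (c + K); first exact: addr_gt0.
move=> n; rewrite -lerBlDl (le_trans (ler_norm _)) // (le_trans (H n)) //.
by rewrite ler_piMr ?(ltW K0) // exprn_ile1 // ltW.
Qed.

Lemma gam_error_sum : exists2 E : R, 0 <= E & forall N, \sum_(n < N) `|gam n - c| <= E.
Proof.
have [K [rho [K0 r0 r1 H]]] := gam_error; exists (K * (1 - rho)^-1).
  by rewrite mulr_ge0 ?invr_ge0 ?subr_ge0 ?ltW.
move=> N; apply: le_trans (ler_wpM2l (ltW K0) (geometric_psum_le N (ltW r0) r1)).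
by rewrite mulr_sumr; apply: ler_sum.
Qed.

Lemma mobius_norm g : `|@mobius P R g| <= 1.
Proof. by rewrite mobiusE; case: ifP => _; rewrite ?normr0 // normrX normrN1 expr1n. Qed.

Lemma muA_norm A g : `|muA R A g| <= 1.
Proof. by rewrite /muA; case: ifP => _; rewrite ?normr0 ?mobius_norm. Qed.

Lemma mm_norm A n : `|mm A n| <= gam n.
Proof.
rewrite normrM [X in _ * X]ger0_norm // ler_wpM2r //.
by apply: le_trans (ler_norm_sum _ _ _) _; apply: ler_sum => g _; exact: muA_norm.
Qed.

(** Density at level n of the elements free of primes from A. It is the product of [mm A] with [gam]
    ([mm_gam]), and positivity bounds it by [gam]. *)
Definition alpha A n : R := scaled_gen (fun g => (mset_over (predC A) g)%:R) n.

Lemma mm_gam A n : conv (mm A) gam n = alpha A n.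
Proof. by rewrite /scaled_gen conv_twist gen_muA. Qed.

Lemma alpha_ge0 A n : 0 <= alpha A n.
Proof. by apply: scaled_gen_ge0. Qed.

Lemma alpha_le A n : alpha A n <= gam n.
Proof. by apply: scaled_gen_le => g; case: mset_over. Qed.

Lemma alpha_predT n : alpha predT n = (n == 0%N)%:R.
Proof.
rewrite /alpha /scaled_gen; case: n => [|n].
  rewrite gen1_lev0 expr0 mulr1 (_ : mset_over _ _) //.
  by apply/mset_overP => p; rewrite in_mset0.
rewrite /gen big_seq big1 ?mul0r // => g; rewrite mem_lev // => /eqP gn.
have /mset_neq0P[p pg] : g != mset0 by rewrite -(mdeg_eq0 deg_gt0) gn.
by have /negPf -> : ~~ mset_over (predC predT) g by apply/mset_overP => /(_ p pg).
Qed.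

(** Analogue of |sum mu(n)/n| <= 1. Replacing [gam] by its limit c in [mm_gam] yields c times the
    partial sum; both [alpha] and the error are bounded independently of A. *)
Lemma psum_mm_bound : exists2 B : R, 0 < B & forall A n, `|psum (mm A) n| <= B.
Proof.
have [Gam Gam0 HG] := gam_bound; have [E E0 HE] := gam_error_sum.
exists ((Gam + Gam * E) / c); first by rewrite divr_gt0 // ltr_wpDr // mulr_ge0 // ltW.
move=> A n; rewrite ler_pdivlMr // -[c in leLHS]gtr0_norm // -normrM.
have -> : psum (mm A) n * c = conv (mm A) gam n - conv (mm A) (fun k => gam k - c) n.
  by rewrite -sumrB mulr_suml; apply: eq_bigr => i _; rewrite -mulrBr opprB addrC subrK.
rewrite (le_trans (ler_normB _ _)) // lerD //.
  by rewrite mm_gam ger0_norm ?alpha_ge0 // (le_trans (alpha_le _ _)).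
rewrite convC (le_trans (ler_norm_sum _ _ _)) //.
rewrite (le_trans _ (ler_wpM2l (ltW Gam0) (HE n.+1))) // mulr_sumr.
apply: ler_sum => i _; rewrite normrM mulrC ler_wpM2r //.
by rewrite (le_trans (mm_norm _ _)).
Qed.

Lemma gam_mm n : conv gam (mm predT) n = (n == 0%N)%:R.
Proof. by rewrite convC mm_gam alpha_predT. Qed.

Definition invb n : R := psum (mm predT) n.

Lemma gam_invb n : conv gam invb n = 1.
Proof.
rewrite /invb -psum_conv /psum (eq_bigr _ (fun (i : 'I_n.+1) _ => gam_mm i)).
by rewrite big_ord_recl big1 ?addr0.
Qed.

Definition d01 (K : pzRingType) n : K := (n == 0%N)%:R - (n == 1%N)%:R.

(* [phi], [mm predT] and [invb] are the coefficients of (1 - z) Z(z / q),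
   1 / Z(z / q) and 1 / ((1 - z) Z(z / q)). *)
Definition phi n : R := conv (d01 R) gam n.

Lemma phiE n : phi n.+1 = gam n.+1 - gam n.
Proof.
rewrite /phi /conv big_ord_recl big_ord_recl /= big1 => [|i _]; last first.
  by rewrite /d01 subrr mul0r.
by rewrite /d01 /bump /= subr0 sub0r mul1r mulN1r addr0 subn0 subn1.
Qed.

Lemma phi0 : phi 0 = 1.
Proof. by rewrite /phi /conv big_ord1 /d01 subr0 mul1r gam0. Qed.

Lemma phi_mm n : conv phi (mm predT) n = d01 R n.
Proof.
by rewrite /phi -convA (eq_conv (fun=> erefl) gam_mm) conv_delta.
Qed.

Lemma phi_invb n : conv phi invb n = (n == 0%N)%:R.
Proof.
rewrite /invb -psum_conv /psum (eq_bigr _ (fun (i : 'I_n.+1) _ => phi_mm i)).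
case: n => [|n]; first by rewrite big_ord1 /d01 subr0.
rewrite big_ord_recl big_ord_recl big1 => [|i _]; last by rewrite /d01 subrr.
by rewrite /d01 /= subr0 sub0r addr0 subrr.
Qed.

Lemma phi_psum n : psum phi n = gam n.
Proof.
elim: n => [|n IH]; first by rewrite psum0 phi0 gam0.
by rewrite psumS IH phiE addrC subrK.
Qed.

Local Notation toC := (real_complex R).
Let phiC n : R[i] := toC (phi n).
Let mmC n : R[i] := toC (mm predT n).

(** Differencing cancels c, so [phi] inherits the geometric decay of gam - c; the 1 in [K1] covers
    phi 0 = 1. *)
Lemma phi_bsum : exists C : R, bsum phiC C /\ bsum (fun n => n%:R * phiC n) C.
Proof.
have [K [rho [K0 r0 r1 H]]] := gam_error.
pose K1 := 1 + K + K / rho.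
have K1_gt0 : 0 < K1 by rewrite /K1 !addr_gt0 // divr_gt0.
have phi_le n : `|phi n| <= K1 * rho ^+ n.
  case: n => [|n].
    by rewrite phi0 expr0 normr1 mulr1 /K1 -addrA lerDl addr_ge0 ?divr_ge0 ?ltW.
  have -> : phi n.+1 = (gam n.+1 - c) - (gam n - c) by rewrite phiE; ring.
  rewrite (le_trans (ler_normB _ _)) // (le_trans (lerD (H n.+1) (H n))) //.
  have -> : K * rho ^+ n.+1 + K * rho ^+ n = (K + K / rho) * rho ^+ n.+1.
    by rewrite exprS; field; rewrite gt_eqF.
  by rewrite ler_wpM2r ?exprn_ge0 ?(ltW r0) // /K1 -addrA lerDr.
have [B HB] := bsum_poly2_geometric (ltW r0) r1.
exists (K1 * B); split=> N; apply: le_trans (ler_wpM2l (ltW K1_gt0) (HB N)).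
  rewrite mulr_sumr; apply: ler_sum => n _; rewrite nc_real (le_trans (phi_le n)) //.
  rewrite ler_wpM2l ?(ltW K1_gt0) // ler_peMl ?exprn_ge0 ?(ltW r0) //.
  by rewrite ler1n muln_gt0.
rewrite mulr_sumr; apply: ler_sum => n _; rewrite ncM -(rmorph_nat toC) nc_real_ge0 //.
rewrite nc_real (le_trans (ler_wpM2l _ (phi_le n))) // mulrCA ler_wpM2l ?(ltW K1_gt0) //.
by rewrite ler_wpM2r ?exprn_ge0 ?(ltW r0) // ler_nat; lia.
Qed.

Lemma phiC_mmC n : conv phiC mmC n = d01 R[i] n.
Proof.
rewrite -(rmorph_conv toC phi (mm predT)) phi_mm /d01 rmorphB.
by rewrite !rmorph_nat.
Qed.

Lemma mmC_bound : exists D : R, forall n, nc (mmC n) <= D.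
Proof.
have [Gam _ HG] := gam_bound; exists Gam => n.
by rewrite nc_real (le_trans (mm_norm _ _)).
Qed.

Lemma phiC_at1 : series_at phiC 1 = toC c.
Proof.
have [C [phiB _]] := phi_bsum; have [K [rho [K0 r0 r1 H]]] := gam_error.
apply: cvgC_unique (cvgC_shift 1 (csumP (bsum_twist_le1 phiB _))) _.
  by rewrite nc1.
apply: (@cvgC_le _ _ _ (fun n => K * rho ^+ n)); last first.
  rewrite -(mulr0 K); apply: cvgMl_tmp; apply: cvg_expr.
  by rewrite ger0_norm // ltW.
move=> n; rewrite addn1; have -> : \sum_(k < n.+1) phiC k * 1 ^+ k = toC (gam n).
  by rewrite -phi_psum /psum rmorph_sum; apply: eq_bigr => k _; rewrite expr1n mulr1.
by rewrite -rmorphB nc_real.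
Qed.

(** * The Euler product of 1/Z and nonvanishing of phi on the closed disc *)

Lemma gen_rmorph (K L : pzSemiRingType) (f : {rmorphism K -> L}) (u : {mset P} -> K) n :
  f (gen deg u n) = gen deg (f \o u) n.
Proof. exact: rmorph_sum. Qed.

Lemma muA_rmorph A g : muA R[i] A g = toC (muA R A g).
Proof.
rewrite /muA !mobiusE; case: ifP => _; rewrite ?rmorph0 //.
by case: ifP => _; rewrite ?rmorph0 // rmorphXn rmorphN1.
Qed.

(** A partial product of 1/Z rather than of Z, hence a polynomial in x. *)
Definition euler N (x : R[i]) : R[i] := \prod_(p <- primes_le deg N) (1 - x ^+ deg p).

Lemma geometric_tail_le (r : R) n N : 0 <= r -> r < 1 ->
  \sum_(n <= k < N) r ^+ k <= r ^+ n * (1 - r)^-1.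
Proof.
move=> r0 r1; rewrite -{1}(add0n n) big_addn big_mkord.
under eq_bigr do rewrite exprD mulrC.
by rewrite -mulr_sumr ler_wpM2l ?exprn_ge0 // geometric_psum_le.
Qed.

(** Up to index N the rescaled coefficients of the partial product agree with those of 1/Z, since
    larger primes cannot occur there. Beyond N they are at most Gam, leaving a geometric tail. *)
Lemma euler_cvg z : nc z < 1 ->
  cvgC (fun N => euler N (z * toC q^-1)) (series_at mmC z).
Proof.
move=> z1; have [Gam Gam0 HG] := gam_bound.
have mmC_le n : nc (mmC n) <= Gam by rewrite nc_real (le_trans (mm_norm _ _)).
have mB := bsum_bounded_geometric mmC_le z1.
pose le_deg N : pred P := fun p => (deg p <= N)%N.
have E N : nc (euler N (z * toC q^-1) - \sum_(k < N.+1) mmC k * z ^+ k) <=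
    Gam * (nc z ^+ N.+1 * (1 - nc z)^-1).
  pose pl : {poly R[i]} := \prod_(p <- primes_le deg N) (1 - 'X^(deg p)).
  have -> : euler N (z * toC q^-1) = pl.[z * toC q^-1].
    rewrite /euler /pl horner_prod; apply: eq_bigr => p _.
    by rewrite hornerD hornerN hornerXn -polyC1 hornerC.
  pose L := maxn (size pl) N.+1.
  rewrite (@horner_coef_wide _ L) ?leq_maxl //.
  have coefE k : pl`_k * (z * toC q^-1) ^+ k = toC (mm (le_deg N) k) * z ^+ k.
    rewrite /pl coef_euler ?primes_le_uniq // /scaled_gen rmorphM rmorphXn /=.
    rewrite [(z * _) ^+ k]exprMn (mulrC (z ^+ k)) mulrA; congr (_ * _ * _).
    rewrite gen_rmorph; apply: eq_gen => g /=; rewrite -muA_rmorph /muA.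
    congr (if _ then _ else _).
    by apply/mset_overP/mset_overP => h p pg; have := h p pg; rewrite /= mem_primes_le.
  under eq_bigr do rewrite coefE.
  rewrite -(big_mkord predT (fun k => toC (mm (le_deg N) k) * z ^+ k)).
  rewrite -(big_mkord predT (fun k => mmC k * z ^+ k)).
  rewrite (@big_cat_nat _ _ _ N.+1) ?leq_maxr //= addrC -addrA.
  rewrite [X in _ + X](_ : _ = 0) ?addr0; last first.
    rewrite -sumrB big_nat_cond big1 // => k /andP[/andP[_ kN] _].
    rewrite /mmC /scaled_gen.
    suff -> : gen deg (muA R (le_deg N)) k = gen deg (muA R predT) k by rewrite subrr.
    by apply: muA_ball => // p pk; rewrite /le_deg (leq_trans pk).
  apply: le_trans (nc_sum _ _ _) _.
  apply: le_trans (ler_wpM2l (ltW Gam0) (geometric_tail_le N.+1 L (nc_ge0 z) z1)).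
  rewrite mulr_sumr; apply: ler_sum => k _; rewrite ncM ncX nc_real.
  by rewrite ler_wpM2r ?exprn_ge0 ?nc_ge0 // (le_trans (mm_norm _ _)).
have c1 : cvgC (fun N => euler N (z * toC q^-1) - \sum_(k < N.+1) mmC k * z ^+ k) 0.
  apply: (@cvgC_le _ _ _ (fun N => Gam * (nc z ^+ N.+1 * (1 - nc z)^-1))).
    by move=> N; rewrite subr0.
  rewrite -(mulr0 Gam); apply: cvgMl_tmp; rewrite -(mul0r (1 - nc z)^-1); apply: cvgMr_tmp.
  have : nc z ^+ n @[n --> \oo] --> (0 : R) by apply: cvg_expr; rewrite ger0_norm ?nc_ge0.
  by rewrite -(cvg_shiftS (fun n => nc z ^+ n)).
have := cvgC_D c1 (cvgC_shift 1 (csumP mB)); rewrite add0r; apply: eq_cvgC => N /=.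
by rewrite addn1 subrK.
Qed.

Lemma cvgC_X (u : nat -> R[i]) l k : cvgC u l -> cvgC (fun n => u n ^+ k) (l ^+ k).
Proof.
move=> ul; elim: k => [|k IH]; first exact: cvgC_cst.
by rewrite exprS; apply: eq_cvgC (cvgC_M ul IH) => n; rewrite exprS.
Qed.

Lemma nc_lim_341 (u1 u2 u3 : nat -> R[i]) l1 l2 l3 : cvgC u1 l1 -> cvgC u2 l2 -> cvgC u3 l3 ->
    (forall n, nc (u1 n) ^+ 3 * nc (u2 n) ^+ 4 * nc (u3 n) <= 1) ->
  nc l1 ^+ 3 * nc l2 ^+ 4 * nc l3 <= 1.
Proof.
move=> c1 c2 c3 u_le; rewrite -(ncX l1) -(ncX l2) -ncM -ncM.
apply: (cvgC_bound (cvgC_M (cvgC_M (cvgC_X 3 c1) (cvgC_X 4 c2)) c3)) => n.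
by rewrite ncM (ncM (u1 n ^+ 3)) !ncX.
Qed.

Lemma nc_prod (I : Type) (s : seq I) (F : I -> R[i]) :
  nc (\prod_(p <- s) F p) = \prod_(p <- s) nc (F p).
Proof. by elim: s => [|x s IH]; rewrite ?big_nil ?nc1 // !big_cons ncM IH. Qed.

Lemma nc_prod_341 (I : Type) (s : seq I) (F1 F2 F3 : I -> R[i]) :
    (forall p, nc (F1 p) ^+ 3 * nc (F2 p) ^+ 4 * nc (F3 p) <= 1) ->
  nc (\prod_(p <- s) F1 p) ^+ 3 * nc (\prod_(p <- s) F2 p) ^+ 4 *
    nc (\prod_(p <- s) F3 p) <= 1.
Proof.
move=> H; rewrite !nc_prod -!prodrXl -!big_split /=.
by apply: prodr_ile1 => p _; rewrite !mulr_ge0 ?exprn_ge0 ?nc_ge0 //=.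
Qed.

Lemma euler_341 N (r : R) w : nc w = 1 -> 0 <= r -> r < 1 ->
  nc (euler N (toC r * toC q^-1)) ^+ 3 * nc (euler N (toC r * w * toC q^-1)) ^+ 4 *
  nc (euler N (toC r * w ^+ 2 * toC q^-1)) <= 1.
Proof.
move=> w1 r0 r1; apply: nc_prod_341 => p.
have x0 : 0 <= r * q^-1 by rewrite mulr_ge0 ?invr_ge0 // ltW.
have x1 : r * q^-1 <= 1 by rewrite ler_pdivrMr // mul1r (le_trans (ltW r1)) // ltW.
have wp : nc (w ^+ deg p) = 1 by rewrite ncX w1 expr1n.
have := product_341 (exprn_ge0 (deg p) x0) (exprn_ile1 (deg p) x0 x1) wp.
have e v : toC ((r * q^-1) ^+ deg p) * v ^+ deg p = (toC r * v * toC q^-1) ^+ deg p.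
  by rewrite rmorphXn rmorphM -exprMn mulrAC.
have -> : (w ^+ deg p) ^+ 2 = (w ^+ 2) ^+ deg p by rewrite -!exprM mulnC.
by rewrite !e rmorphXn rmorphM.
Qed.

Lemma mmC_341 (r : R) w : nc w = 1 -> 0 <= r -> r < 1 ->
  nc (series_at mmC (toC r)) ^+ 3 * nc (series_at mmC (toC r * w)) ^+ 4 *
  nc (series_at mmC (toC r * w ^+ 2)) <= 1.
Proof.
move=> w1 r0 r1; have ncr v : nc v = 1 -> nc (toC r * v) < 1.
  by move=> v1; rewrite ncM v1 mulr1 nc_real_ge0.
have w21 : nc (w ^+ 2) = 1 by rewrite ncX w1 expr1n.
have rr1 : nc (toC r) < 1 by rewrite nc_real_ge0.
apply: nc_lim_341 (euler_cvg rr1) (euler_cvg (ncr w w1)) (euler_cvg (ncr _ w21)) _ => N.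
exact: euler_341.
Qed.

Lemma real_limit (y : nat -> R) (l : R[i]) : cvgC (fun n => toC (y n)) l ->
  l = toC (complex.Re l) /\ y n @[n --> \oo] --> complex.Re l.
Proof.
move=> yl; have I0 : complex.Im l = 0.
  apply/eqP; rewrite -normr_eq0 eq_le normr_ge0 andbT.
  have := yl => /cvg_lim <- //; apply: limr_ge; first by apply/cvg_ex; exists 0.
  near=> n; apply: le_trans (normr_Im _).
  by case: (l) => a b /=; rewrite sub0r normrN.
split; first by move: I0; case: (l) => a b /= ->.
apply/subr_cvg0; apply: cvg0_le yl => n; apply: le_trans (normr_Re _).
by case: (l) => a b.
Unshelve. all: by end_near. Qed.

Lemma ZG_phi (r : R) : 0 <= r -> r < 1 ->
  nc (series_at phiC (- toC r)) = (1 + r) * `|ZG deg (- r / q)|.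
Proof.
move=> r0 r1; have z1 : nc (- toC r) < 1 by rewrite ncN nc_real_ge0.
have [C [phiB _]] := phi_bsum; have [D mD] := mmC_bound.
have FM := series_mul1B phiB mD phiC_mmC z1.
pose y N : R := \prod_(p <- primes_le deg N) (1 - (- r / q) ^+ deg p).
have yE N : toC (y N) = euler N (- toC r * toC q^-1).
  rewrite /y /euler rmorph_prod; apply: eq_bigr => p _.
  by rewrite rmorphB rmorph1 rmorphXn rmorphM rmorphN.
have yl : cvgC (fun N => toC (y N)) (series_at mmC (- toC r)).
  by apply: eq_cvgC (euler_cvg z1) => N; rewrite yE.
have [lE ly] := real_limit yl; move: FM lE ly; set l := series_at mmC _ => FM lE ly.
have r10 : 0 < 1 + r by rewrite ltr_wpDr.
have FM1 : nc (series_at phiC (- toC r)) * `|complex.Re l| = 1 + r.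
  rewrite -(nc_real (complex.Re l)) -lE -ncM FM opprK -(rmorph1 toC) -rmorphD.
  by rewrite nc_real_ge0 // ltW.
(* The limit times phi(-r) has modulus 1 + r > 0, so the limit of the inverted products exists. *)
have l0 : complex.Re l != 0.
  by apply: contraTneq r10 => h; rewrite -FM1 h normr0 mulr0 ltxx.
have -> : ZG deg (- r / q) = (complex.Re l)^-1.
  apply: cvg_lim => //.
  have -> : (fun N => Zpart deg N (- r / q)) = (fun N => (y N)^-1).
    apply/funext => N; rewrite /Zpart /y.
    rewrite (prod_primes_le deg_gt0 fin_deg N (fun k => 1 - (- r / q) ^+ k)).
    by rewrite prodfV.
  exact: cvgV.
by rewrite normfV -FM1 mulfK // normr_eq0.
Qed.

Hypothesis Z_neq0 : exists2 L : R, L != 0 & ZG deg x @[x --> (- q^-1)^'+] --> L.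

(** If phi(-1) = 0, the Lipschitz bound and [ZG_phi] give |Z(-r/q)| <= C (1 - r), so Z tends to 0 at
    -1/q from the right, against [Z_neq0]. *)
Lemma phiC_atN1 : series_at phiC (-1) != 0.
Proof.
apply/eqP => F0; have [L L0 ZL] := Z_neq0; move/eqP: L0; apply.
have [C [phiB phi'B]] := phi_bsum.
have n1 : nc (-1 : R[i]) <= 1 by rewrite ncN nc1.
have bnd x : - q^-1 < x -> x <= 0 -> `|ZG deg x| <= C * (1 + q * x).
  move=> x1 x0; pose r := - (q * x).
  have xE : x = - r / q by rewrite /r opprK mulrC mulKf // gt_eqF.
  have r0 : 0 <= r by rewrite /r oppr_ge0 pmulr_rle0.
  have r1 : r < 1.
    by move: x1; rewrite ltrNl -(ltr_pM2l q_gt0) mulfV ?gt_eqF // mulrN.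
  have h : nc (series_at phiC (- toC r)) <= C * (1 - r).
    rewrite -[series_at _ _]subr0 -F0 (le_trans (series_lipschitz phiB phi'B _ n1)) //.
      by rewrite ncN nc_real_ge0 // ltW.
    rewrite opprK addrC -(rmorph1 toC) -rmorphB nc_real_ge0 // subr_ge0; exact: ltW.
  have -> : 1 + q * x = 1 - r by rewrite /r opprK.
  apply: le_trans h; rewrite (ZG_phi r0 r1) -xE ler_peMl // lerDl.
  by [].
have Z0 : ZG deg x @[x --> (- q^-1)^'+] --> (0 : R).
  apply/norm_cvg0P; apply: (@squeeze_cvgr _ _ _ _ (fun=> 0) (fun x => C * (1 + q * x))).
  - near=> x; rewrite normr_ge0 /= bnd //; near: x.
    by apply: nbhs_right_le; rewrite oppr_lt0 invr_gt0.
  - exact: cvg_cst.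
  - have : (C * (1 + q * x)) @[x --> - q^-1] --> C * (1 + q * (- q^-1)).
      apply: cvgMl_tmp; apply: cvgD; first exact: cvg_cst.
      by apply: cvgMl_tmp; exact: cvg_id.
    rewrite mulrN mulfV ?gt_eqF // subrr mulr0; exact: cvg_at_right_filter.
exact: (cvg_unique _ ZL Z0).
Unshelve. all: by end_near. Qed.

Lemma phiC_neq0 z : nc z <= 1 -> series_at phiC z != 0.
Proof.
rewrite le_eqVlt => /orP[/eqP z1|z1]; have [C [phiB phi'B]] := phi_bsum;
  have [D mD] := mmC_bound; apply/eqP => F0.
  have [zE|zE] := circle_zero phiB phi'B mD phiC_mmC (fun r => mmC_341 z1) z1 F0.
    move: F0; rewrite zE phiC_at1 => /(congr1 (@complex.Re R)) /= /eqP.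
    by rewrite gt_eqF.
  by have := phiC_atN1; rewrite -zE F0 eqxx.
have := series_mul1B phiB mD phiC_mmC z1; rewrite F0 mul0r => /esym/eqP.
rewrite subr_eq0 => /eqP zE; move: z1; rewrite -zE nc1.
by rewrite ltxx.
Qed.

Lemma invb_summable : exists B : R, forall N, \sum_(n < N) `|invb n| <= B.
Proof.
have [C [phiB phi'B]] := phi_bsum; have [Gam Gam0 HG] := gam_bound.
have [delta d0 Hd] := disc_lower_bound phiB phi'B phiC_neq0.
have inv n : conv phiC (fun k => toC (invb k)) n = (n == 0%N)%:R.
  by rewrite -(rmorph_conv toC phi invb) phi_invb rmorph_nat.
(* The a priori growth asked for by [inverse_bsum]: n + 1 terms of size at most Gam. *)
have bD n : nc (toC (invb n)) <= Gam * n.+1%:R.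
  rewrite nc_real (le_trans (ler_norm_sum _ _ _)) // mulr_natr -[n.+1 in leRHS]card_ord.
  rewrite -sumr_const; apply: ler_sum => k _; exact: le_trans (mm_norm _ _) (HG _).
have [B HB] := inverse_bsum phiB phi'B inv bD d0 Hd.
by exists B => N; apply: le_trans (HB N); apply: ler_sum => n _; rewrite nc_real.
Qed.

(** * Limits of Moebius sums over all primes but those of bounded degree *)

Lemma summable_cvg0 (u : nat -> R) (B : R) : (forall n, 0 <= u n) ->
  (forall N, \sum_(k < N) u k <= B) -> u n @[n --> \oo] --> (0 : R).
Proof.
move=> u0 uB; apply/cvgrPdist_le => e e0; have [K HK] := sum_tail_le u0 uB e0.
near=> n; have Kn : (K <= n)%N by near: n; exists K.
rewrite sub0r normrN ger0_norm //; apply: le_trans (HK n.+1).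
by rewrite big_nat_recr //= lerDr sumr_ge0.
Unshelve. all: by end_near. Qed.

Lemma invb_cvg0 : `|invb n| @[n --> \oo] --> (0 : R).
Proof. by have [B HB] := invb_summable; apply: summable_cvg0 HB. Qed.

Lemma conv_norm_le (u v : nat -> R) n :
  `|conv u v n| <= conv (fun k => `|u k|) (fun k => `|v k|) n.
Proof.
by apply: le_trans (ler_norm_sum _ _ _) _; apply: ler_sum => i _; rewrite normrM.
Qed.

(** In gam * invb = 1 replace [gam] by c: the error is the summable gam - c convolved with the null
    sequence [invb]. *)
Lemma psum_invb_cvg : psum invb n @[n --> \oo] --> c^-1.
Proof.
have [E E0 HE] := gam_error_sum.
have h : conv (fun k => gam k - c) invb n @[n --> \oo] --> (0 : R).
  apply: cvg0_le (fun n => conv_norm_le _ _ n) _.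
  by apply: conv_cvg0 invb_cvg0 _ _ HE.
have pE n : psum invb n = c^-1 * (1 - conv (fun k => gam k - c) invb n).
  apply: (mulfI (lt0r_neq0 c_gt0)); rewrite mulrA mulfV ?mul1r ?gt_eqF //.
  rewrite -[X in _ = X - _](gam_invb n) !(convC _ invb) -sumrB /psum mulr_sumr.
  by apply: eq_bigr => i _; rewrite -mulrBr opprB addrC subrK mulrC.
rewrite (_ : psum invb = (fun n => c^-1 * (1 - conv (fun k => gam k - c) invb n))); last first.
  by apply/funext => n; exact: pE.
rewrite -[X in _ --> X]mulr1; apply: cvgMl_tmp; rewrite -[X in _ --> X]subr0.
by apply: cvgB => //; exact: cvg_cst.
Qed.

Lemma sum_shift (K : nmodType) (v : nat -> K) d N :
  \sum_(n < N) (if (d <= n)%N then v (n - d)%N else 0) = \sum_(n < N - d) v n.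
Proof.
elim: N => [|N IH]; first by rewrite sub0n !big_ord0.
rewrite big_ord_recr /= IH; case: ifPn => [dN|]; first by rewrite subSn // big_ord_recr.
rewrite -ltnNge => Nd; have -> : (N.+1 - d = 0)%N by lia.
have -> : (N - d = 0)%N by lia.
by rewrite !big_ord0 addr0.
Qed.

Lemma psum_shift (K : nmodType) (v : nat -> K) d N :
  psum (fun n => if (d <= n)%N then v (n - d)%N else 0) N =
  if (d <= N)%N then psum v (N - d) else 0.
Proof.
rewrite /psum sum_shift; case: ifPn => [dN|]; first by rewrite subSn.
by rewrite -ltnNge => Nd; have -> : (N.+1 - d = 0)%N; [lia | rewrite big_ord0].
Qed.

Lemma ler_sum_ord (v : nat -> R) m N : (forall n, 0 <= v n) -> (m <= N)%N ->
  \sum_(n < m) v n <= \sum_(n < N) v n.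
Proof.
move=> v0 mN; rewrite -!(big_mkord predT v) [leRHS](big_cat_nat (leq0n m) mN) /=.
by rewrite lerDl sumr_ge0.
Qed.

Lemma over_summable (s : seq P) : exists B : R, forall N,
  \sum_(n < N) scaled_gen (fun g => (mset_over (mem s) g)%:R) n <= B.
Proof.
pose o (s' : seq P) (g : {mset P}) : R := (mset_over (mem s') g)%:R.
elim: s => [|p s [B HB]].
  exists 1 => -[|N]; first by rewrite big_ord0.
  rewrite big_ord_recl big1 => [|i _]; last exact: (alpha_predT (bump 0 i)).
  by rewrite addr0 -[leLHS]/(alpha predT 0) alpha_predT.
(* An element over p :: s is over s or contains p, so a partial sum T satisfies T <= B + T / q, as
   deg p >= 1. *)
exists (B / (1 - q^-1)) => N; have q1 : 0 < 1 - q^-1 by rewrite subr_gt0 invf_lt1.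
have o_le g : o (p :: s) g <= o s g + (if p \in g then o (p :: s) (g `\ p)%mset else 0).
  rewrite /o; case: ifPn => pg.
    case: (boolP (mset_over (mem (p :: s)) g)) => [/mset_overP ov|_]; last by rewrite addr_ge0.
    rewrite [X in _ <= _ + X](_ : _ = 1) ?lerDr //.
    rewrite (_ : mset_over _ _) //; apply/mset_overP => x; rewrite in_msetB1 => /andP[_].
    exact: ov.
  rewrite addr0 ler_nat; case: (boolP (mset_over (mem (p :: s)) g)) => // /mset_overP ov.
  rewrite (_ : mset_over _ _) //; apply/mset_overP => x xg.
  have /orP[/eqP xp|//] : (x == p) || (x \in s) by rewrite -in_cons; exact: ov.
  by rewrite xp (negPf pg) in xg.
have o_le' n : scaled_gen (o (p :: s)) n <= scaled_gen (o s) n +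
    q^-1 * (if (deg p <= n)%N then scaled_gen (o (p :: s)) (n - deg p) else 0).
  apply: le_trans (scaled_gen_le n o_le) _.
  rewrite /scaled_gen /gen big_split /= mulrDl lerD2l.
  have := gen_shift fin_deg (o (p :: s)) p n; rewrite /gen => ->.
  case: ifPn => pn; last by rewrite mul0r mulr0.
  have -> : q^-1 ^+ n = q^-1 ^+ deg p * q^-1 ^+ (n - deg p) by rewrite -exprD subnKC.
  rewrite [leLHS]mulrCA ler_wpM2r //.
    by rewrite mulr_ge0 //; apply: sumr_ge0 => g _; rewrite /o.
  rewrite -[leRHS]expr1 ler_wiXn2l ?invr_ge0 ?(ltW q_gt0) //.
  by rewrite invf_le1 // ltW.
rewrite ler_pdivlMr // mulrBr mulr1 lerBlDr.
apply: le_trans (ler_sum _ (fun (n : 'I_N) _ => o_le' n)) _.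
rewrite big_split /=; apply: lerD; first exact: HB.
rewrite -mulr_sumr mulrC ler_wpM2r ?invr_ge0 ?(ltW q_gt0) //.
rewrite sum_shift; apply: ler_sum_ord (leq_subr _ _) => n.
by apply: scaled_gen_ge0 => g; rewrite /o.
Qed.

(** Restricting to A multiplies 1/Z by the finite Euler product over the omitted primes:
    [psum (mm A)] is [alpha A] convolved with [invb], a summable sequence with a null one. *)
Lemma psum_mm_cvg0 A d : (forall p, ~~ A p -> (deg p <= d)%N) ->
  psum (mm A) n @[n --> \oo] --> (0 : R).
Proof.
move=> Ad; have [B HB] := over_summable (primes_le deg d).
have alphaB N : \sum_(n < N) alpha A n <= B.
  apply: le_trans (HB N); apply: ler_sum => n _; apply: scaled_gen_le => g.
  rewrite ler_nat; case: (boolP (mset_over (predC A) g)) => // /mset_overP ov.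
  rewrite (_ : mset_over _ _) //; apply/mset_overP => p pg.
  by rewrite -[mem _ p]/(p \in primes_le deg d) mem_primes_le // Ad //; exact: ov.
have pE n : psum (mm A) n = conv (alpha A) invb n.
  rewrite /invb -psum_conv; apply: eq_bigr => i _.
  rewrite -(eq_conv (mm_gam A) (fun=> erefl)) -convA.
  by rewrite (eq_conv (fun=> erefl) gam_mm) conv_delta.
rewrite (_ : psum (mm A) = conv (alpha A) invb); last by apply/funext.
apply: cvg0_le (fun n => conv_norm_le _ _ n) _.
apply: conv_cvg0 invb_cvg0 _ _ _ => // N.
by under eq_bigr do rewrite ger0_norm ?alpha_ge0 //.
Qed.

(** * Chebyshev and Mertens bounds for primes *)

Definition mertens d : R := \sum_(p <- primes_le deg d) q^-1 ^+ deg p.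

(* Summing the degrees of the distinct primes of [g] over all [g] of degree [n]
   gives at most [n] per [g]; this is the convolution bounded as [key]. *)
Lemma chebyshev_sum : exists2 C : R, 0 <= C & forall N,
  \sum_(k < N.+1) k%:R * ((pcount deg k)%:R * q^-1 ^+ k) <= C * N.+1%:R.
Proof.
have [Gam Gam0 HG] := gam_bound.
have [j0 Hj] : exists j0, forall j, (j0 <= j)%N -> c / 2 <= gam j.
  have [K [rho [K0 r0 r1 H]]] := gam_error.
  have : K * rho ^+ n @[n --> \oo] --> (0 : R).
    rewrite -(mulr0 K); apply: cvgMl_tmp; apply: cvg_expr.
    by rewrite ger0_norm // ltW.
  move/cvgrPdist_le => /(_ (c / 2)); rewrite divr_gt0 // => /(_ isT)[j0 _ Hj].
  exists j0 => j /Hj /=; rewrite sub0r normrN => h.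
  have := H j; have := ler_norm (K * rho ^+ j); rewrite ler_norml => h2 /andP[h3 _].
  lra.
have key n : \sum_(k < n.+1) k%:R * ((pcount deg k)%:R * q^-1 ^+ k) * gam (n - k) <= n%:R * Gam.
  apply: le_trans (ler_wpM2l (ler0n _ n) (HG n)).
  have -> : \sum_(k < n.+1) k%:R * ((pcount deg k)%:R * q^-1 ^+ k) * gam (n - k)
    = \sum_(p <- primes_le deg n) (deg p)%:R * q^-1 ^+ deg p * gam (n - deg p).
    rewrite (sum_primes_le fin_deg n (fun k => k%:R * q^-1 ^+ k * gam (n - k))).
    by apply: eq_bigr => k _; ring.
  have -> : \sum_(p <- primes_le deg n) (deg p)%:R * q^-1 ^+ deg p * gam (n - deg p)
    = scaled_gen (fun g => \sum_(p <- finsupp g) (deg p)%:R) n.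
    rewrite /scaled_gen (gen_sum_finsupp fin_deg (u := fun p _ => (deg p)%:R)
      (s := primes_le deg n));
      [|exact: primes_le_uniq|by move=> p _ pn; rewrite mem_primes_le // pn].
    rewrite mulr_suml big_seq [RHS]big_seq; apply: eq_bigr => p; rewrite mem_primes_le // => pn.
    have -> : q^-1 ^+ n = q^-1 ^+ deg p * q^-1 ^+ (n - deg p) by rewrite -exprD subnKC.
    rewrite pn (_ : gen deg (fun=> (deg p)%:R) _ = (deg p)%:R * gen deg (fun=> 1) (n - deg p)).
      by ring.
    by rewrite /gen mulr_sumr; apply: eq_bigr => g _; rewrite mulr1.
  rewrite /scaled_gen mulrA ler_wpM2r // /gen mulr_sumr big_seq [leRHS]big_seq; apply: ler_sum => g.
  rewrite mem_lev // => /eqP gn; rewrite mulr1 -natr_sum ler_nat -gn /mdeg sum_mset.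
  rewrite big_seq [leqRHS]big_seq; apply: leq_sum => p; rewrite msuppE => pg.
  by rewrite leq_pmull // mset_gt0.
exists (2 * Gam * j0.+1%:R / c).
  by rewrite divr_ge0 ?mulr_ge0 // ltW.
move=> N; rewrite mulrAC ler_pdivlMr //.
(* At level N + j0 each k <= N leaves a cofactor of degree at least j0, where [gam] is at least c /
   2; the other terms are nonnegative and dropped. *)
have := key (N + j0)%N; rewrite -(ler_pM2l (ltr0n R 2)) => key'.
have h1 : (\sum_(k < N.+1) k%:R * ((pcount deg k)%:R * q^-1 ^+ k)) * c <=
   2 * \sum_(k < (N + j0).+1) k%:R * ((pcount deg k)%:R * q^-1 ^+ k) * gam (N + j0 - k).
  rewrite mulr_suml mulr_sumr.
  apply: (@le_trans _ _ (\sum_(k < N.+1) 2 * (k%:R * ((pcount deg k)%:R * q^-1 ^+ k) * gam (N + j0 - k)))).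
    apply: ler_sum => k _; rewrite [leRHS]mulrCA ler_wpM2l ?mulr_ge0 //.
    have jk : (j0 <= N + j0 - k)%N by have := ltn_ord k; lia.
    by have := Hj _ jk; lra.
  apply: (@ler_sum_ord (fun k => 2 * (k%:R * ((pcount deg k)%:R * q^-1 ^+ k) * gam (N + j0 - k)))).
    by move=> k; rewrite mulr_ge0 // mulr_ge0 ?gam_ge0 // mulr_ge0 // mulr_ge0.
  by lia.
have h2 : 2 * ((N + j0)%:R * Gam) <= 2 * Gam * j0.+1%:R * N.+1%:R.
  rewrite -!mulrA ler_pM2l // mulrC ler_pM2l // -natrM ler_nat; nia.
exact: le_trans h1 (le_trans key' h2).
Qed.

Lemma pcount0 : pcount deg 0 = 0%N.
Proof.
rewrite (pcountE fin_deg (leqnn 0)) big1 // => p /eqP p0.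
by have := deg_gt0 p; rewrite p0.
Qed.

Lemma harmonic_le n : \sum_(k < n.+1) (k.+1%:R^-1 : R) <= 1 + ln n.+1%:R.
Proof.
elim: n => [|n IH]; first by rewrite big_ord1 invr1 ln1 addr0.
rewrite big_ord_recr /= (le_trans (lerD IH (lexx _))) // -addrA lerD2l -lerBrDl.
have n1 : (0 : R) < n.+1%:R by []; have n2 : (0 : R) < n.+2%:R by [].
have := @le_ln1Dx R (- n.+2%:R^-1); rewrite ltrN2 invf_lt1 ?ltr1n // => /(_ isT).
have -> : 1 - n.+2%:R^-1 = n.+1%:R / n.+2%:R :> R.
  have nE : (n.+2%:R : R) = n.+1%:R + 1 by rewrite natr1.
  rewrite nE in n2 *; move: n1 n2; move: (n.+1%:R : R) => x x0 x1.
  by field; rewrite gt_eqF.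
by rewrite ln_div ?posrE // => h; rewrite -lerN2 opprB.
Qed.

Lemma mertens_le : exists2 C : R, 0 <= C & forall d, (0 < d)%N -> mertens d <= C * (2 + ln d%:R).
Proof.
have [C C0 HC] := chebyshev_sum; exists C => // d d0.
pose w k : R := (pcount deg k)%:R * q^-1 ^+ k.
pose s N := \sum_(k < N.+1) k%:R * w k.
have sE N : s N.+1 = s N + N.+1%:R * w N.+1 by rewrite /s big_ord_recr.
(* Abel summation run as an induction: the Chebyshev bound s(N+1) <= C (N+2) makes the change of the
   boundary term at most C / (N+1). *)
have H N : \sum_(k < N) w k.+1 <= s N / N.+1%:R + C * \sum_(k < N) k.+1%:R^-1.
  elim: N => [|N IH].
    by rewrite !big_ord0 mulr0 addr0 /s big_ord1 mul0r mul0r.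
  rewrite !big_ord_recr /= mulrDr.
  have sN := HC N.+1; rewrite -/(s N.+1) in sN.
  have wE : w N.+1 = (s N.+1 - s N) / N.+1%:R.
    by rewrite sE addrC addKr mulrC mulKf // pnatr_eq0.
  have n1 : (0 : R) < N.+1%:R by []; have n2 : (0 : R) < N.+2%:R by [].
  have nE : (N.+2%:R : R) = N.+1%:R + 1 by rewrite -natr1.
  have step : s N.+1 / N.+1%:R - s N.+1 / N.+2%:R <= C / N.+1%:R.
    rewrite -subr_ge0.
    have -> : C / N.+1%:R - (s N.+1 / N.+1%:R - s N.+1 / N.+2%:R) =
      (C * N.+2%:R - s N.+1) / (N.+1%:R * N.+2%:R).
      move: n1 n2; rewrite nE; move: (N.+1%:R : R) => x x0 x1.
      by field; rewrite !gt_eqF.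
    by rewrite divr_ge0 ?mulr_ge0 // subr_ge0.
  rewrite wE mulrBl; move: IH step; move: (s N / _) (s N.+1 / _) (s N.+1 / _).
  move: (C / _) (C * _) (\sum_(_ < _) _) => x1 x2 x3 x4 x5 x6; lra.
have -> : mertens d = \sum_(k < d) w k.+1.
  rewrite /mertens (sum_primes_le fin_deg d (fun k => q^-1 ^+ k)).
  by rewrite big_ord_recl pcount0 mul0r add0r.
apply: le_trans (H d) _.
have h1 : s d / d.+1%:R <= C by rewrite ler_pdivrMr //; exact: HC.
have h2 : \sum_(k < d) (k.+1%:R^-1 : R) <= 1 + ln d%:R.
  by case: d d0 {h1} => // d _; exact: harmonic_le.
have h3 := ler_wpM2l C0 h2; apply: le_trans (lerD h1 h3) _.
by rewrite -[X in X + _]mulr1 -mulrDr ler_wpM2l // addrA.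
Qed.

(** * Sums over elements with a minimal prime in S *)

Variables (S : set P) (f : nat -> R[i]) (Mf : R).
Hypothesis f_le : forall n, nc (f n) <= Mf.

Local Notation qi := (toC q^-1).
Local Notation has := (hasPmin deg S).
Local Notation mu := (@mobius P R[i]).

Let Mf_ge0 : 0 <= Mf. Proof. by apply: le_trans (f_le 0); exact: nc_ge0. Qed.
Let nc_qiX n : nc (qi ^+ n) = q^-1 ^+ n.
Proof. by rewrite -rmorphXn nc_real_ge0. Qed.

(** The weight F is a parameter because f also occurs cut off below a given degree ([trunc]). *)
Definition peel (F : nat -> R[i]) n : R[i] :=
  gen deg (fun g => if has g then mu g * F (dminus deg g) else 0) n * qi ^+ n.

Lemma has0 : has mset0 = false.
Proof. by apply/negP => /hasPmin_neq0; rewrite eqxx. Qed.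

Lemma gamCE n : toC (gam n) = gen deg (fun=> 1) n * qi ^+ n.
Proof.
rewrite /scaled_gen rmorphM rmorphXn gen_rmorph; congr (_ * _).
Qed.

Lemma QS_conv n :
  gen deg (fun g => (QS deg S g)%:R * f (dplus deg g)) n * qi ^+ n =
  - conv (peel f) (fun k => toC (gam k)) n.
Proof.
rewrite (eq_conv (fun=> erefl) gamCE) /peel conv_twist -gen_conv // -mulNr.
congr (_ * _); rewrite /gen -sumrN; apply: eq_bigr => g _.
under eq_bigr do rewrite mulr1.
by rewrite duality // opprK.
Qed.

(** Sorts the elements by minimal prime p; the cofactor has all its primes above deg p. Since F
    vanishes beyond d, the list of primes does not depend on n. *)
Lemma peelE F d n : (forall k, (d < k)%N -> F k = 0) ->
  peel F n = - \sum_(p <- primes_le deg d)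
    (if `[< S p >] then F (deg p) * qi ^+ deg p else 0) *
    (if (deg p <= n)%N then toC (mm (above deg (deg p)) (n - deg p)) else 0).
Proof.
move=> F0; rewrite /peel.
pose u p g : R[i] := if `[< S p >] then F (deg p) * muA R[i] (above deg (deg p)) g else 0.
have -> : gen deg (fun g => if has g then mu g * F (dminus deg g) else 0) n =
    - gen deg (fun g => \sum_(p <- finsupp g) u p (g `\ p)%mset) n.
  rewrite /gen -sumrN; apply: eq_bigr => g _.
  by rewrite mobius_peel // big_mkcond.
rewrite (gen_sum_finsupp fin_deg (u := u) (s := primes_le deg d)); first last.
- move=> p g pn; rewrite mem_primes_le // -ltnNge => dp.
  by rewrite /u F0 // mul0r if_same.
- exact: primes_le_uniq.
rewrite mulNr mulr_suml; congr (- _); apply: eq_bigr => p _.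
case: ifPn => pn; last by rewrite mul0r mulr0.
rewrite /u; case: ifPn => Sp; last by rewrite mul0r /gen big1 // mul0r.
have -> : qi ^+ n = qi ^+ deg p * qi ^+ (n - deg p) by rewrite -exprD subnKC.
have -> : toC (mm (above deg (deg p)) (n - deg p)) =
    gen deg (muA R[i] (above deg (deg p))) (n - deg p) * qi ^+ (n - deg p).
  rewrite /scaled_gen rmorphM rmorphXn gen_rmorph; congr (_ * _).
  by apply: eq_gen => g; rewrite muA_rmorph.
have -> : gen deg (fun g => F (deg p) * muA R[i] (above deg (deg p)) g) (n - deg p) =
    F (deg p) * gen deg (muA R[i] (above deg (deg p))) (n - deg p).
  by rewrite /gen mulr_sumr.
by ring.
Qed.

Lemma psum_toC (u : nat -> R) n : psum (fun k => toC (u k)) n = toC (psum u n).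
Proof. by rewrite /psum rmorph_sum. Qed.

Lemma psum_peelE F d N : (forall k, (d < k)%N -> F k = 0) ->
  psum (peel F) N = - \sum_(p <- primes_le deg d)
    (if `[< S p >] then F (deg p) * qi ^+ deg p else 0) *
    (if (deg p <= N)%N then toC (psum (mm (above deg (deg p))) (N - deg p)) else 0).
Proof.
move=> F0; rewrite /psum (eq_bigr _ (fun (n : 'I_N.+1) _ => peelE n F0)) sumrN.
rewrite exchange_big /=; congr (- _); apply: eq_bigr => p _; rewrite -mulr_sumr.
congr (_ * _); have := psum_shift (fun k => toC (mm (above deg (deg p)) k)) (deg p) N.
by rewrite psum_toC.
Qed.

(** The cofactor sums involve a different set A for each p, so the bound B must be uniform in A;
    what remains is the sum of 1/|p|. *)
Lemma psum_peel_le B F d N : (forall A n, `|psum (mm A) n| <= B) ->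
    (forall k, nc (F k) <= Mf) -> (forall k, (d < k)%N -> F k = 0) ->
  nc (psum (peel F) N) <= Mf * B * mertens d.
Proof.
move=> HB F_le F0; rewrite (psum_peelE N F0) ncN.
have B0 : 0 <= B by apply: le_trans (HB predT 0%N).
apply: le_trans (nc_sum _ _ _) _; rewrite /mertens mulr_sumr; apply: ler_sum => p _.
rewrite ncM mulrAC; apply: ler_pM; rewrite ?nc_ge0 //.
  case: ifP => _; last by rewrite nc0 mulr_ge0.
  by rewrite ncM nc_qiX ler_wpM2r.
by case: ifP => _; [rewrite nc_real | rewrite nc0].
Qed.

Lemma cvgC_sum0 (I : Type) (s : seq I) (u : I -> nat -> R[i]) :
  (forall i, cvgC (u i) 0) -> cvgC (fun n => \sum_(i <- s) u i n) 0.
Proof.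
move=> h; elim: s => [|x s IH].
  by apply: eq_cvgC (cvgC_cst 0) => n; rewrite big_nil.
have := cvgC_D (h x) IH; rewrite addr0; apply: eq_cvgC => n.
by rewrite big_cons.
Qed.

Lemma cvgC_real0 (u : nat -> R) : u n @[n --> \oo] --> (0 : R) -> cvgC (fun n => toC (u n)) 0.
Proof.
move=> u0; apply: (@cvgC_le _ _ _ (fun n => `|u n|)) => [n|]; first by rewrite subr0 nc_real.
exact/norm_cvg0P.
Qed.

Lemma cvgC_unshift (u : nat -> R[i]) l k : cvgC (fun n => u (n + k)%N) l -> cvgC u l.
Proof. by rewrite /cvgC => h; rewrite -(cvg_shiftn k). Qed.

Lemma psum_peel_cvg0 F d : (forall k, (d < k)%N -> F k = 0) -> cvgC (psum (peel F)) 0.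
Proof.
move=> F0.
pose v p N := (if `[< S p >] then F (deg p) * qi ^+ deg p else 0) *
    (if (deg p <= N)%N then toC (psum (mm (above deg (deg p))) (N - deg p)) else 0).
have v0 p : cvgC (v p) 0.
  have := @cvgC_M _ _ _ _ _ (cvgC_cst (if `[< S p >] then F (deg p) * qi ^+ deg p else 0)).
  rewrite -[X in cvgC (v p) X](mulr0 (if `[< S p >] then F (deg p) * qi ^+ deg p else 0)).
  apply; apply: (@cvgC_unshift _ _ (deg p)).
  have : psum (mm (above deg (deg p))) n @[n --> \oo] --> (0 : R).
    by apply: (@psum_mm_cvg0 _ (deg p)) => x; rewrite /above -leqNgt.
  by move/cvgC_real0; apply: eq_cvgC => n; rewrite leq_addl addnK.
have := cvgC_N (cvgC_sum0 (primes_le deg d) v0); rewrite oppr0; apply: eq_cvgC => N.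
by rewrite (psum_peelE N F0).
Qed.

(* Splitting (mu * a)(g) over g = r + h, [tau h] collects the cofactors [r] of [h]. *)
Definition tau h n : R[i] :=
  gen deg (fun r => if has (r `+` h)%mset then mu r * f (dminus deg (r `+` h)%mset) else 0) n
  * qi ^+ n.

Definition trunc d : nat -> R[i] := fun k => if (k < d)%N then f k else 0.

(** [hasPmin_shift] summed over r: either p stays minimal, or a smaller prime of r takes over, which
    gives a term of (ii) with f cut off at deg p. *)
Lemma tauE h p n : isPmin deg S h p ->
  tau h n = f (deg p) * toC (mm (fun x => (deg p < deg x)%N || (x == p)) n)
    + peel (trunc (deg p)) n.
Proof.
move=> hP; rewrite /tau /peel /scaled_gen rmorphM rmorphXn mulrA -mulrDl; congr (_ * _).
rewrite gen_rmorph /gen mulr_sumr -big_split; apply: eq_bigr => r _ /=.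
have := hasPmin_shift f r hP; rewrite -/(trunc (deg p) (dminus deg r)) => H.
have -> : (if has (r `+` h)%mset then mu r * f (dminus deg (r `+` h)%mset) else 0) =
  mu r * (if has (r `+` h)%mset then f (dminus deg (r `+` h)%mset) else 0).
  by case: ifP; rewrite ?mulr0.
rewrite H mulrDr -muA_rmorph /muA; congr (_ + _).
  by case: ifP; rewrite ?mulr0 // mulrC.
by case: ifP; rewrite ?mulr0.
Qed.

Lemma psum_tauE h p N : isPmin deg S h p ->
  psum (tau h) N = f (deg p) * toC (psum (mm (fun x => (deg p < deg x)%N || (x == p))) N)
    + psum (peel (trunc (deg p))) N.
Proof.
move=> hP; rewrite /psum (eq_bigr _ (fun (n : 'I_N.+1) _ => tauE n hP)) big_split /=.
by rewrite -mulr_sumr rmorph_sum.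
Qed.

Lemma trunc0 d k : (d < k)%N -> trunc d k = 0.
Proof. by move=> dk; rewrite /trunc ltnNge (ltnW dk). Qed.

Lemma trunc_le d k : nc (trunc d k) <= Mf.
Proof. by rewrite /trunc; case: ifP => // _; rewrite nc0. Qed.

Lemma mertens_ge0 d : 0 <= mertens d.
Proof. by apply: sumr_ge0. Qed.

Lemma mertens_mono d d' : (d <= d')%N -> mertens d <= mertens d'.
Proof.
move=> dd; rewrite /mertens !(sum_primes_le fin_deg _ (fun k => q^-1 ^+ k)).
by apply: (@ler_sum_ord (fun k => (pcount deg k)%:R * q^-1 ^+ k)) => // k; rewrite mulr_ge0.
Qed.

Lemma psum_tau_le B h N : (forall A n, `|psum (mm A) n| <= B) -> has h ->
  nc (psum (tau h) N) <= Mf * B * (1 + mertens (mdeg deg h)).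
Proof.
move=> HB /asboolP[p hP]; rewrite (psum_tauE N hP).
have B0 : 0 <= B by apply: le_trans (HB predT 0%N).
rewrite (le_trans (ncD _ _)) // mulrDr mulr1 lerD //.
  by rewrite ncM nc_real ler_pM ?nc_ge0.
apply: le_trans (psum_peel_le N HB (trunc_le (deg p)) (@trunc0 (deg p))) _.
rewrite ler_wpM2l ?mulr_ge0 // mertens_mono //.
by case: hP => ph _ _; exact: deg_le_mdeg.
Qed.

Lemma psum_tau_cvg0 h : has h -> cvgC (psum (tau h)) 0.
Proof.
move=> /asboolP[p hP].
pose A := fun x => (deg p < deg x)%N || (x == p).
have c1 : psum (mm A) n @[n --> \oo] --> (0 : R).
  by apply: (@psum_mm_cvg0 _ (deg p)) => x; rewrite /A negb_or -leqNgt => /andP[].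
have := cvgC_D (cvgC_M (cvgC_cst (f (deg p))) (cvgC_real0 c1)) (psum_peel_cvg0 (@trunc0 (deg p))).
by rewrite mulr0 addr0; apply: eq_cvgC => N; rewrite (psum_tauE N hP).
Qed.

Lemma conv_cvgC0 (x y : nat -> R[i]) (B : R) : cvgC x 0 -> bsum y B -> cvgC (conv y x) 0.
Proof.
move=> x0 yB; pose nx n : R := nc (x n - 0); pose ny n : R := nc (y n).
apply: (@cvgC_le _ _ _ (conv ny nx)).
  move=> n; rewrite subr0 (le_trans (nc_sum _ _ _)) //; apply: ler_sum => i _.
  by rewrite ncM /nx subr0.
by apply: (@conv_cvg0 _ _ _ B) => // n; exact: nc_ge0.
Qed.

Lemma conv_toC (u v : nat -> R) n :
  conv (fun k => toC (u k)) (fun k => toC (v k)) n = toC (conv u v n).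
Proof. by rewrite rmorph_conv. Qed.

Lemma QS_mean_iff (delta : R) :
  cvgC (fun n => gen deg (fun g => (QS deg S g)%:R * f (dplus deg g)) n * qi ^+ n) (toC (c * delta))
  <-> cvgC (psum (peel f)) (- toC delta).
Proof.
pose Aq n := gen deg (fun g => (QS deg S g)%:R * f (dplus deg g)) n * qi ^+ n.
pose gC k := toC (gam k); pose eC k := toC (gam k - c); pose bC k := toC (invb k).
have [E E0 HE] := gam_error_sum; have [B HB] := invb_summable.
have eB : bsum eC E by move=> N; apply: le_trans (HE N); apply: ler_sum => k _; rewrite nc_real.
have bB : bsum bC B by move=> N; apply: le_trans (HB N); apply: ler_sum => k _; rewrite nc_real.
split=> [H|H].
  have bc : cvgC (psum bC) (toC c^-1).
    apply: (@cvgC_le _ _ _ (fun n => `|psum invb n - c^-1|)) => [n|].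
      by rewrite psum_toC -rmorphB nc_real.
    by apply/norm_cvg0P/subr_cvg0; exact: psum_invb_cvg.
  (* Convolving [QS_conv] with [invb] turns [gam] into the constant 1, that is, into partial
     summation; the expected main term of (i) is then split off. *)
  have psE n : psum (peel f) n = - (conv bC (fun k => Aq k - toC (c * delta)) n
      + toC (c * delta) * psum bC n).
    have -> : conv bC (fun k => Aq k - toC (c * delta)) n =
       conv bC Aq n - toC (c * delta) * psum bC n.
      rewrite /conv /psum mulr_sumr -sumrB; apply: eq_bigr => i _.
      by rewrite mulrBr [X in _ - X]mulrC.
    rewrite subrK.
    have -> : conv bC Aq n = - psum (peel f) n; last by rewrite opprK.
    rewrite (eq_conv (fun=> erefl) QS_conv) convC convNl -convA; congr (- _).
    rewrite -conv1; apply: eq_conv => // m.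
    by rewrite /bC conv_toC gam_invb rmorph1.
  have H0 : cvgC (fun k => Aq k - toC (c * delta)) 0.
    by have := cvgC_B H (cvgC_cst (toC (c * delta))); rewrite subrr.
  have := cvgC_N (cvgC_D (conv_cvgC0 H0 bB) (cvgC_M (cvgC_cst (toC (c * delta))) bc)).
  rewrite add0r -rmorphM mulrAC mulfV ?gt_eqF // mul1r.
  by apply: eq_cvgC => n; rewrite psE.
(* Terms of a convergent series tend to 0, so their convolution with the summable gam - c disappears
   and only c times the partial sums remains. *)
have u0 : cvgC (peel f) 0.
  apply: (@cvgC_unshift _ _ 1).
  have := cvgC_B (cvgC_shift 1 H) H; rewrite subrr; apply: eq_cvgC => n.
  by rewrite addn1 psumS [psum _ _ + _]addrC addrK.
have := cvgC_N (cvgC_D (cvgC_M (cvgC_cst (toC c)) H) (conv_cvgC0 u0 eB)).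
rewrite addr0 mulrN opprK -rmorphM; apply: eq_cvgC => n.
rewrite QS_conv; congr (- _); rewrite (convC eC) /conv /psum mulr_sumr -big_split /=.
by apply: eq_bigr => i _; rewrite mulrC -mulrDr /eC -rmorphD addrC subrK.
Qed.

(** * Comparison of the series in (ii) and (iii) *)

Variable a : {mset P} -> R[i].
Hypotheses (a_supp : forall g, ~ inD deg S g -> a g = 0) (a_e : a mset0 = 1).

Definition mu_conv_term n : R[i] :=
  gen deg (fun g => if has g then mu_conv a g * f (dminus deg g) else 0) n * qi ^+ n.

(** The part of (iii) with deg h = j and deg r = k, where h is the argument of a and r that of
    mu. *)
Definition theta j k : R[i] := \sum_(h <- lev deg j) a h * qi ^+ j * tau h k.

Lemma a_has h : h != mset0 -> ~~ has h -> a h = 0.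
Proof. by move=> h0 /negP nh; apply: a_supp => /(inD_hasPmin deg S h0). Qed.

Lemma mu_convE g : mu_conv a g = \sum_(h <- sub_mset deg g) mu h * a (g `\` h)%mset.
Proof.
rewrite /mu_conv (@fsbig_seqE _ _ _ (sub_mset deg g)) ?sub_mset_uniq //; last first.
  by move=> h /= hg; rewrite mem_sub_mset.
rewrite big_seq_cond [RHS]big_seq; apply: eq_bigl => h.
by rewrite mem_sub_mset //; apply/andP/idP => [[]//|hg]; split=> //; exact/asboolP.
Qed.

Lemma mu_conv_termE n : mu_conv_term n = \sum_(j < n.+1) theta j (n - j).
Proof.
pose W r h : R[i] := if has (r `+` h)%mset then mu r * a h * f (dminus deg (r `+` h)%mset) else 0.
have -> : mu_conv_term n =
    (\sum_(g <- lev deg n) \sum_(r <- sub_mset deg g) W r (g `\` r)%mset) * qi ^+ n.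
  congr (_ * _); apply: eq_bigr => g _; rewrite big_seq.
  case: ifPn => hg; last first.
    rewrite big1 // => r; rewrite mem_sub_mset // => rg.
    by rewrite /W msetBDKC // (negPf hg).
  rewrite mu_convE big_seq mulr_suml; apply: eq_bigr => r; rewrite mem_sub_mset // => rg.
  by rewrite /W msetBDKC // hg.
(* [sum_pairs] is indexed by the degree of r; the reversal indexes by the degree of h. *)
rewrite sum_pairs // mulr_suml (reindex_inj rev_ord_inj) /=; apply: eq_bigr => j _.
have jn : (j <= n)%N by rewrite -ltnS.
rewrite subSS subKn // exchange_big /= mulr_suml; apply: eq_bigr => h _.
have -> : \sum_(r <- lev deg (n - j)) W r h = a h * gen deg (fun r =>
    if has (r `+` h)%mset then mu r * f (dminus deg (r `+` h)%mset) else 0) (n - j).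
  rewrite /gen mulr_sumr; apply: eq_bigr => r _.
  by rewrite /W; case: ifP => _; rewrite ?mulr0 // mulrCA mulrA.
have -> : qi ^+ n = qi ^+ j * qi ^+ (n - j) by rewrite -exprD subnKC.
by rewrite /tau; ring.
Qed.

Lemma theta0 k : theta 0 k = peel f k.
Proof.
rewrite /theta (perm_big _ (lev0 deg_gt0 fin_deg)) big_seq1 a_e expr0 !mul1r /tau /peel.
by congr (_ * _); apply: eq_bigr => r _; rewrite msetD0.
Qed.

Lemma triangle_sum (K : nmodType) (t : nat -> nat -> K) n :
  psum (fun m => \sum_(j < m.+1) t j (m - j)%N) n = \sum_(j < n.+1) psum (t j) (n - j).
Proof.
elim: n => [|n IH]; first by rewrite /psum !big_ord1.
rewrite /psum in IH *; rewrite big_ord_recr /= IH [X in _ + X = _]big_ord_recr.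
rewrite [RHS]big_ord_recr /= subnn big_ord1 addrA; congr (_ + _).
rewrite -big_split; apply: eq_bigr => j _ /=.
have jn : (j <= n)%N by rewrite -ltnS.
by rewrite subSn // [RHS]big_ord_recr.
Qed.

Lemma psum_theta j N : psum (theta j) N = \sum_(h <- lev deg j) a h * qi ^+ j * psum (tau h) N.
Proof.
rewrite /psum /theta exchange_big /=; apply: eq_bigr => h _.
by rewrite mulr_sumr.
Qed.

Definition a_level j : R :=
  gen deg (fun h => if has h then nc (a h) else 0) j * q^-1 ^+ j.

Lemma a_level_ge0 j : 0 <= a_level j.
Proof. by rewrite mulr_ge0 //; apply: sumr_ge0 => h _; case: ifP => // _; exact: nc_ge0. Qed.

Lemma lnln_qX k : (0 < k)%N -> ln (ln (q ^+ k)) = ln k%:R + ln (ln q).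
Proof.
move=> k0; have lq : 0 < ln q by exact: ln_gt0.
by rewrite lnXn // -[ln q *+ k]mulr_natl lnM ?posrE ?ltr0n.
Qed.

Hypothesis a_sum : exists L : R,
  psum (fun k => a_level k * ln (ln (q ^+ k))) n @[n --> \oo] --> L.

(** By [mertens_le], 1 + mertens k is O(log log q^k), so the hypothesis on a provides the majorant.
    As log log q^k may be negative for small k, the comparison starts at [k1]. *)
Lemma a_level_bounded : exists B : R, forall N,
  \sum_(j < N) a_level j * (1 + mertens j) <= B.
Proof.
have [C C0 HC] := mertens_le; have [L HL] := a_sum.
have /cvgP/cvg_seq_bounded[M [_ HM]] := HL.
have {HM} HM n : `|psum (fun k => a_level k * ln (ln (q ^+ k))) n| <= M + 1.
  by apply: (HM (M + 1)); rewrite // ltrDl.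
pose l := ln (ln q).
(* Beyond [k1] one has ln k >= 2 - 2 l, equivalently 2 + ln k <= 2 (ln k + l), which compares the
   Mertens bound with log log q^k. *)
pose k1 := (Num.bound (expR (2 - 2 * l))).+1.
have Hk1 k : (k1 <= k)%N -> 1 + mertens k <= (1 + C) * 2 * ln (ln (q ^+ k)).
  move=> k1k; have k0 : (0 < k)%N by apply: leq_trans k1k.
  have lnk : 2 - 2 * l <= ln k%:R.
    rewrite -(expRK (2 - 2 * l)) ler_ln ?posrE ?expR_gt0 ?ltr0n //.
    apply: le_trans (ltW (archi_boundP (expR_ge0 _))) _.
    by rewrite ler_nat (leq_trans _ k1k).
  rewrite lnln_qX // -/l; have := HC k k0; have := ln_ge0 (_ : 1 <= k%:R :> R).
  rewrite ler1n => /(_ k0) lnk0; nra.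
have terms_ge0 k : (k1 <= k)%N -> 0 <= a_level k * ln (ln (q ^+ k)).
  move=> k1k; rewrite mulr_ge0 ?a_level_ge0 //; have := Hk1 k k1k.
  by have := mertens_ge0 k; nra.
pose w j := a_level j * (1 + mertens j).
have w0 j : 0 <= w j by rewrite mulr_ge0 ?a_level_ge0 // addr_ge0 // mertens_ge0.
exists (\sum_(j < k1) w j + (1 + C) * 2 * (2 * (M + 1))) => N.
have [Nk|kN] := leqP N k1.
  apply: (@le_trans _ _ (\sum_(j < k1) w j)); first exact: ler_sum_ord.
  by rewrite lerDl; apply: mulr_ge0; have := le_trans (normr_ge0 _) (HM 0%N); lra.
rewrite -/w -(big_mkord predT w) (big_cat_nat (leq0n k1) (ltnW kN)) /= big_mkord lerD2l.
apply: (@le_trans _ _ (\sum_(k1 <= k < N) (1 + C) * 2 * (a_level k * ln (ln (q ^+ k))))).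
  rewrite big_nat_cond [leRHS]big_nat_cond; apply: ler_sum => k /andP[/andP[k1k _] _].
  by rewrite mulrCA ler_wpM2l ?a_level_ge0 // Hk1.
rewrite -mulr_sumr ler_wpM2l ?mulr_ge0 ?addr_ge0 //.
have E n : psum (fun k => a_level k * ln (ln (q ^+ k))) n =
    \sum_(0 <= k < n.+1) a_level k * ln (ln (q ^+ k)) by rewrite big_mkord.
(* The block from [k1] to N is a difference of two partial sums; the predecessors appear because
   [psum] includes its endpoint. *)
have := HM N.-1; have := HM k1.-1; rewrite !E !prednK //; last exact: leq_ltn_trans kN.
rewrite [X in _ -> `|X| <= _ -> _](big_cat_nat (leq0n k1) (ltnW kN)) /=.
by rewrite !ler_norml => /andP[h1 h2] /andP[h3 h4]; lra.
Qed.

Lemma mu_conv_sum_diff : cvgC (fun n => psum mu_conv_term n - psum (peel f) n) 0.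
Proof.
have [B B0 HB] := psum_mm_bound; have [Ba HBa] := a_level_bounded.
(* The index 0 is zeroed: h = 0 contributes exactly the sum in (ii), which is subtracted. *)
pose t j n : R := if j is j'.+1 then nc (psum (theta j) (n - j)) else 0.
apply: (@cvgC_le _ _ _ (fun n => \sum_(j < n.+1) t j n)).
  move=> n; rewrite subr0.
  have -> : psum mu_conv_term n = psum (fun m => \sum_(j < m.+1) theta j (m - j)) n.
    by apply: eq_bigr => m _; exact: mu_conv_termE.
  rewrite triangle_sum big_ord_recl /= subn0.
  have -> : psum (theta 0) n = psum (peel f) n by apply: eq_bigr => k _; exact: theta0.
  rewrite addrAC subrr add0r big_ord_recl /= add0r.
  exact: nc_sum.
pose w j := Mf * B * (a_level j * (1 + mertens j)).
apply: (@tannery _ t w (Mf * B * Ba)).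
- move=> [|j] n jn; rewrite /t /w.
    rewrite lexx /=; apply: mulr_ge0; first by rewrite mulr_ge0 // ltW.
    by rewrite mulr_ge0 ?a_level_ge0 // addr_ge0 // mertens_ge0.
  rewrite nc_ge0 /= psum_theta (le_trans (nc_sum _ _ _)) //.
  rewrite /a_level mulrA mulrAC /gen mulr_suml mulr_sumr.
  rewrite big_seq [leRHS]big_seq; apply: ler_sum => h; rewrite mem_lev // => /eqP hj.
  have h0 : h != mset0 by rewrite -(mdeg_eq0 deg_gt0) hj.
  case: ifPn => hh; last first.
    by rewrite (a_has h0 hh) !mul0r nc0 mulr0.
  rewrite !ncM nc_qiX mulrC ler_wpM2r ?mulr_ge0 ?nc_ge0 //.
  by rewrite -hj; exact: psum_tau_le.
- move=> [|j]; first exact: cvg_cst.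
  suff : cvgC (fun n => psum (theta j.+1) (n - j.+1)) 0.
    by rewrite /cvgC; under eq_fun do rewrite subr0.
  apply: (@cvgC_unshift _ _ j.+1).
  have th0 h : cvgC (fun n => if has h then a h * qi ^+ j.+1 * psum (tau h) n else 0) 0.
    case: (boolP (has h)) => [hh|_]; last exact: cvgC_cst.
    by have := cvgC_M (cvgC_cst (a h * qi ^+ j.+1)) (psum_tau_cvg0 hh); rewrite mulr0.
  apply: eq_cvgC (cvgC_sum0 (lev deg j.+1) th0) => n; rewrite addnK psum_theta.
  rewrite big_seq [RHS]big_seq; apply: eq_bigr => h; rewrite mem_lev // => /eqP hj.
  have h0 : h != mset0 by rewrite -(mdeg_eq0 deg_gt0) hj.
  by case: ifPn => // hh; rewrite (a_has h0 hh) !mul0r.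
- move=> N; rewrite -mulr_sumr ler_wpM2l ?mulr_ge0 ?(ltW B0) //.
Qed.

Lemma mu_conv_sum_iff l : cvgC (psum (peel f)) l <-> cvgC (psum mu_conv_term) l.
Proof.
split=> H.
  have := cvgC_D mu_conv_sum_diff H; rewrite add0r; apply: eq_cvgC => n.
  by rewrite subrK.
have := cvgC_B H mu_conv_sum_diff; rewrite subr0; apply: eq_cvgC => n.
by rewrite opprB addrC subrK.
Qed.

(** [hasPmin] fails at the identity, so the requirement of positive degree is built in. *)
Lemma fsbig_D (K : nmodType) (F : {mset P} -> K) n :
  \sum_(g \in [set g : {mset P} | (1 <= mdeg deg g <= n)%N /\ inD deg S g]) F g =
  psum (gen deg (fun g => if has g then F g else 0)) n.
Proof.
rewrite (@fsbig_seqE _ _ _ (ball deg n)) ?ball_uniq //; last first.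
  by move=> g /= [/andP[_ gn] _]; rewrite mem_ball.
rewrite big_mkcond big_ball //; apply: eq_bigr => k _; rewrite /gen.
rewrite big_seq [RHS]big_seq; apply: eq_bigr => g; rewrite mem_lev // => /eqP gk.
suff -> : `[< [set g | (1 <= mdeg deg g <= n)%N /\ inD deg S g] g >] = has g by [].
have [->|g0] := eqVneq g mset0.
  by rewrite has0; apply/asboolPn => -[]; rewrite mdeg0.
apply/asboolP/idP => /= [[_ /(inD_hasPmin deg S g0)] //|hg].
split; last exact/(inD_hasPmin deg S g0).
by rewrite lt0n (mdeg_eq0 deg_gt0) g0 /= gk -ltnS ltn_ord.
Qed.

End ArithmeticalSemigroup.

Theorem theorem2p3 (R : realType) (P : countType) (deg : P -> nat)
  (deg_gt0 : forall p : P, (0 < deg p)%N)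
  (fin_deg : forall n : nat, finite_set [set g : {mset P} | mdeg deg g = n])
  (c q eta : R) (c_gt0 : 0 < c) (q_gt1 : 1 < q) (eta_ge0 : 0 <= eta) (eta_lt1 : eta < 1)
  (axiomA : exists (K : R) (N : nat), forall n : nat, (N <= n)%N ->
      `| Gcount deg R n - c * q ^+ n | <= K * q `^ (eta * n%:R))
  (Z_neq0 : exists2 L : R, L != 0 &
      ZG deg x @[x --> (- q^-1)^'+] --> L)
  (S : set P) (delta : R)
  (densS : (pcountS deg S n)%:R / (pcount deg n)%:R @[n --> \oo] --> delta)
  (f : nat -> R[i]) (f_bdd : exists M : R, forall n, Normc.normc (f n) <= M)
  (f0 : f 0%N = 0)
  (a : {mset P} -> R[i]) (a_supp : forall g, ~ inD deg S g -> a g = 0)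
  (a_e : a mset0 = 1)
  (a_sum : exists L : R,
      \sum_(g \in [set g : {mset P} | (1 <= mdeg deg g <= n)%N /\ inD deg S g])
         (Normc.normc (a g) / q ^+ mdeg deg g * ln (ln (q ^+ mdeg deg g)))
      @[n --> \oo] --> L) :
  [<->
    (* (i) *)
    Normc.normc (\sum_(g \in [set g : {mset P} | mdeg deg g = n])
                   ((QS deg S g)%:R * f (dplus deg g))
                 - (c * delta * q ^+ n)%:C%C) / q ^+ n @[n --> \oo] --> (0 : R);
    (* (ii) *)
    cvgC (fun n => \sum_(g \in [set g : {mset P} | (1 <= mdeg deg g <= n)%N /\ inD deg S g])
                     (mobius R[i] g * f (dminus deg g) / (q ^+ mdeg deg g)%:C%C))
         (- delta%:C%C);
    (* (iii) *)
    cvgC (fun n => \sum_(g \in [set g : {mset P} | (1 <= mdeg deg g <= n)%N /\ inD deg S g])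
                     (mu_conv a g * f (dminus deg g) / (q ^+ mdeg deg g)%:C%C))
         (- delta%:C%C)
  ].
Proof.
have [Mf f_le] := f_bdd.
have q_gt0 : 0 < q by exact: lt_trans q_gt1.
(* The norm is constant on a level and factors out as a power of 1/q. *)
have level (F : {mset P} -> R[i]) n :
    gen deg (fun g => if hasPmin deg S g then F g / (q ^+ mdeg deg g)%:C%C else 0) n =
    gen deg (fun g => if hasPmin deg S g then F g else 0) n * (q^-1)%:C%C ^+ n.
  rewrite /gen mulr_suml big_seq [RHS]big_seq; apply: eq_bigr => g.
  rewrite (mem_lev fin_deg) => /eqP gn; case: ifP => _; last by rewrite mul0r.
  by rewrite gn -rmorphXn exprVn rmorphV // unitfE expf_neq0 // gt_eqF.
have iP : (Normc.normc (\sum_(g \in [set g : {mset P} | mdeg deg g = n])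
                   ((QS deg S g)%:R * f (dplus deg g))
                 - (c * delta * q ^+ n)%:C%C) / q ^+ n @[n --> \oo] --> (0 : R)) <->
    cvgC (fun n => gen deg (fun g => (QS deg S g)%:R * f (dplus deg g)) n * (q^-1)%:C%C ^+ n)
      (c * delta)%:C%C.
  rewrite /cvgC; under eq_fun => n.
    rewrite (fsbig_lev fin_deg) -/(gen deg _ n).
    have -> : nc (gen deg (fun g => (QS deg S g)%:R * f (dplus deg g)) n -
        (c * delta * q ^+ n)%:C%C) / q ^+ n =
      nc (gen deg (fun g => (QS deg S g)%:R * f (dplus deg g)) n * (q^-1)%:C%C ^+ n
        - (c * delta)%:C%C).
      have -> : (c * delta)%:C%C = (c * delta * q ^+ n)%:C%C * (q^-1)%:C%C ^+ n :> R[i].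
        by rewrite -rmorphXn -rmorphM exprVn mulfK // expf_neq0 // gt_eqF.
      rewrite -mulrBl ncM -rmorphXn nc_real_ge0 ?exprVn //.
      by rewrite invr_ge0 exprn_ge0 // ltW.
    over.
  by [].
have iiP l : cvgC (fun n => \sum_(g \in [set g : {mset P} | (1 <= mdeg deg g <= n)%N /\ inD deg S g])
                     (mobius R[i] g * f (dminus deg g) / (q ^+ mdeg deg g)%:C%C)) l <->
    cvgC (psum (peel deg q S f)) l.
  have E n : \sum_(g \in [set g : {mset P} | (1 <= mdeg deg g <= n)%N /\ inD deg S g])
       (mobius R[i] g * f (dminus deg g) / (q ^+ mdeg deg g)%:C%C) = psum (peel deg q S f) n.
    rewrite (fsbig_D deg_gt0 fin_deg); apply: eq_bigr => k _; exact: level.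
  by split; apply: eq_cvgC => n; rewrite E.
have iiiP l : cvgC (fun n => \sum_(g \in [set g : {mset P} | (1 <= mdeg deg g <= n)%N /\ inD deg S g])
                     (mu_conv a g * f (dminus deg g) / (q ^+ mdeg deg g)%:C%C)) l <->
    cvgC (psum (mu_conv_term deg q S f a)) l.
  have E n : \sum_(g \in [set g : {mset P} | (1 <= mdeg deg g <= n)%N /\ inD deg S g])
       (mu_conv a g * f (dminus deg g) / (q ^+ mdeg deg g)%:C%C)
      = psum (mu_conv_term deg q S f a) n.
    rewrite (fsbig_D deg_gt0 fin_deg); apply: eq_bigr => k _; exact: level.
  by split; apply: eq_cvgC => n; rewrite E.
have a_sum' : exists L : R,
    psum (fun k => a_level deg q S a k * ln (ln (q ^+ k))) n @[n --> \oo] --> L.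
  have [L HL] := a_sum; exists L.
  have E n : psum (fun k => a_level deg q S a k * ln (ln (q ^+ k))) n =
     \sum_(g \in [set g : {mset P} | (1 <= mdeg deg g <= n)%N /\ inD deg S g])
         (nc (a g) / q ^+ mdeg deg g * ln (ln (q ^+ mdeg deg g))).
    rewrite (fsbig_D deg_gt0 fin_deg); apply: eq_bigr => k _.
    rewrite /a_level /gen !mulr_suml big_seq [RHS]big_seq; apply: eq_bigr => g.
    rewrite (mem_lev fin_deg) => /eqP gk; case: ifP => _; last by rewrite !mul0r.
    by rewrite gk exprVn.
  by under eq_fun do rewrite E.
have H12 := QS_mean_iff deg_gt0 fin_deg c_gt0 q_gt1 eta_lt1 axiomA Z_neq0 S f delta.
have H23 := mu_conv_sum_iff deg_gt0 fin_deg c_gt0 q_gt1 eta_lt1 axiomA Z_neq0 f_le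
  a_supp a_e a_sum' (- delta%:C%C).
split; first by move=> /iP/H12/iiP.
split; first by move=> /iiP/H23/iiiP.
by move=> /iiiP/H23/H12/iP.
Qed.
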